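(* Let $N\ge1$ and let $\Gamma_0(z),\Gamma_1(z),\Gamma_2(z)\in\mathrm{End}(V_1\otimes\cdots\otimes V_N)$ be the twisted column operators with parameters $(x_1,\dots,x_N)$. (a) For each $k\in\{0,1,2\}$, $\Gamma_k(z)=\Gamma_k(z;x_1,\dots,x_N)$ is invariant under simultaneous permutation of the alphabet $(x_1,\dots,x_N)$ and of the spaces $V_1,\dots,V_N$: writing $\langle\langle i_1,\dots,i_N\|\Gamma_k(z;x_1,\dots,x_N)\|j_1,\dots,j_N\rangle\rangle$ for its matrix entries, one has for every permutation $\sigma\in\mathfrak{S}_N$ $$\langle\langle i_{\sigma(1)},\dots,i_{\sigma(N)}\|\Gamma_k(z;x_{\sigma(1)},\dots,x_{\sigma(N)})\|j_{\sigma(1)},\dots,j_{\sigma(N)}\rangle\rangle=\langle\langle i_1,\dots,i_N\|\Gamma_k(z;x_1,\dots,x_N)\|j_1,\dots,j_N\rangle\rangle .$$ (b) The operators satisfy the exchange relations of the Yang--Baxter algebra of the Izergin--Korepin model: for all $k,\ell\in\{0,1,2\}$ and parameters $z,y$, $$\Gamma_k(z)\Gamma_\ell(y)=\sum_{i=0}^{2}\sum_{j=0}^{2}W_{z/y}(i,j;k,\ell)\,\Gamma_j(y)\Gamma_i(z).$$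
   Context: **Weights.** All parameters ($q$ and the spectral parameters) are generic/indeterminates. For $i,j,k,\ell\in\{0,1,2\}$ the Izergin--Korepin vertex weight $W_{y/x}(i,j;k,\ell)$ depends on $x,y$ only through $y/x$, and, with $D=(x-q^2y)(x-q^3y)$, is given by $W(0,0;0,0)=W(2,2;2,2)=1$; $W(1,0;1,0)=W(2,1;2,1)=\frac{q^2(x-y)}{x-q^2y}$; $W(1,0;0,1)=W(2,1;1,2)=\frac{(1-q^2)x}{x-q^2y}$; $W(0,1;1,0)=W(1,2;2,1)=\frac{(1-q^2)y}{x-q^2y}$; $W(0,1;0,1)=W(1,2;1,2)=\frac{x-y}{x-q^2y}$; $W(2,0;2,0)=\frac{q^4(x-y)(x-qy)}{D}$; $W(2,0;1,1)=-\frac{q(1-q)^2(1+q)x(x-y)}{D}$; $W(2,0;0,2)=\frac{(1-q^2)x(x+qx-qy-q^3y)}{D}$; $W(1,1;2,0)=-\frac{q^4(1+q)(x-y)y}{D}$; $W(1,1;1,1)=\frac{-qx^2+(1+q)(1-q^2+q^4)xy-q^4y^2}{D}$; $W(1,1;0,2)=\frac{(1+q)x(x-y)}{D}$; $W(0,2;2,0)=\frac{(1-q^2)(x+q^2x-q^2y-q^3y)y}{D}$; $W(0,2;1,1)=\frac{q(1-q)^2(1+q)(x-y)y}{D}$; $W(0,2;0,2)=\frac{(x-y)(x-qy)}{D}$; and $W=0$ in all other cases. ($W_{z/y}$ is obtained by the substitution $x\mapsto y$, $y\mapsto z$.) **Local matrices.** $V_i\cong\mathbb{C}^3$ with basis indexed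 by $0,1,2$ (rows and columns of $3\times3$ matrices are indexed in this order); a subscript $i$ means the matrix acts on $V_i$ and as the identity on the other factors. Let $E_i^{a,b}$ denote the elementary matrix with a 1 in row $a$, column $b$, acting on $V_i$. Diagonal matrices: $d_i(z)=\mathrm{diag}\left(1,\frac{x_i-z}{x_i-q^2z},\frac{(x_i-z)(x_i-qz)}{(x_i-q^2z)(x_i-q^3z)}\right)_i$, $d_i^{\circ}(z)=\mathrm{diag}\left(1,\frac{(qx_i-z)(x_i-q^2z)}{(1+q)(x_i-z)},\frac{x_i-q^3z}{x_i-qz}\right)_i$, $d_i^{\bullet}(z)=\mathrm{diag}\left(1,\frac{1+q}{qx_i-z},\frac{x_i-q^2z}{x_i-z}\right)_i$, $d_i^{\bullet\circ}(z)=\mathrm{diag}\left(1,\frac{x_i-q^2z}{x_i-z},\frac{(x_i-q^2z)(x_i-q^3z)}{(x_i-z)(x_i-qz)}\right)_i$. Non-diagonal matrices: $e_i^{\circ}(z)=\frac{(1-q^2)z}{x_i-q^2z}E_i^{1,0}$, $e_i^{\bullet}(z)=\frac{q(1-q)^2(1+q)(x_i-z)z}{(x_i-q^2z)(x_i-q^3z)}E_i^{2,1}$, $e_i^{\bullet\circ}(z)=\frac{(1-q^2)(x_i+q^2x_i-q^2z-q^3z)z}{(x_i-q^2z)(x_i-q^3z)}E_i^{2,0}$. For $i\ne j$: $e_{ij}^{\circ\circ}(z)=\frac{x_ix_j+q^2x_ix_j-q^2x_iz-q^2x_jz}{(1-q^2)z}e_i^{\circ}(z)e_j^{\circ}(z)$,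 $e_{ij}^{\bullet\circ}(z)=e_{ji}^{\circ\bullet}(z)=\frac{x_ix_j+q^2x_ix_j-q^2x_iz-q^3x_jz}{q(1-q)(x_i-x_j)z}e_i^{\bullet}(z)e_j^{\circ}(z)$, $e_{ij}^{\bullet\bullet}(z)=\frac{(1+q)(x_ix_j+q^2x_ix_j-q^3x_iz-q^3x_jz)}{q(1-q)(x_i-qx_j)(x_j-qx_i)z}e_i^{\bullet}(z)e_j^{\bullet}(z)$. **Twisted column operators.** $$\Gamma_0(z)=\prod_{i=1}^{N}d_i(z),\qquad \Gamma_1(z)=\sum_{u\in\{\circ,\bullet\}}\sum_{i=1}^{N}e_i^{u}(z)\prod_{j\ne i}d_j(z)d_j^{u}(x_i),$$ $$\Gamma_2(z)=\sum_{i=1}^{N}e_i^{\bullet\circ}(z)\prod_{j\ne i}d_j(z)d_j^{\bullet\circ}(x_i)+\sum_{u,v\in\{\circ,\bullet\}}\ \sum_{1\le i<j\le N}e_{ij}^{uv}(z)\prod_{k\ne i,j}d_k(z)d_k^{u}(x_i)d_k^{v}(x_j).$$ *)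

(* Defs.v *)
From HB Require Import structures.
From mathcomp Require Import all_boot all_order all_fingroup all_algebra.

Set Implicit Arguments.
Unset Strict Implicit.
Unset Printing Implicit Defensive.

Import GRing.Theory.
Local Open Scope ring_scope.

(* Genericity of the parameters is rendered over an arbitrary field as the     *)
(* nonvanishing of the denominators occurring in the formulas below.           *)
(* Indeterminates are the case where F is a field of rational functions.       *)

Definition generic_q (F : fieldType) (q : F) : Prop :=
  [/\ q != 0, 1 - q != 0 & 1 + q != 0].

Definition generic_x (F : fieldType) (N : nat) (q : F) (x : 'I_N -> F) : Prop :=
  forall i j : 'I_N, i != j -> x i - x j != 0 /\ x i - q * x j != 0.

Definition generic_z (F : fieldType) (N : nat) (q : F) (x : 'I_N -> F)
    (z : F) : Prop :=
  z != 0 /\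
  forall i : 'I_N, x i - q ^+ 2 * z != 0 /\ x i - q ^+ 3 * z != 0.

Definition generic_W (F : fieldType) (q x y : F) : Prop :=
  x - q ^+ 2 * y != 0 /\ x - q ^+ 3 * y != 0.

(* [IKweight q x y i j k l] is W_{y/x}(i, j; k, l): note the order of x, y.    *)
Definition IKweight (F : fieldType) (q x y : F) (i j k l : 'I_3) : F :=
  let D := (x - q ^+ 2 * y) * (x - q ^+ 3 * y) in
  match nat_of_ord i, nat_of_ord j, nat_of_ord k, nat_of_ord l with
  | 0, 0, 0, 0 | 2, 2, 2, 2 => 1
  | 1, 0, 1, 0 | 2, 1, 2, 1 => q ^+ 2 * (x - y) / (x - q ^+ 2 * y)
  | 1, 0, 0, 1 | 2, 1, 1, 2 => (1 - q ^+ 2) * x / (x - q ^+ 2 * y)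
  | 0, 1, 1, 0 | 1, 2, 2, 1 => (1 - q ^+ 2) * y / (x - q ^+ 2 * y)
  | 0, 1, 0, 1 | 1, 2, 1, 2 => (x - y) / (x - q ^+ 2 * y)
  | 2, 0, 2, 0 => q ^+ 4 * (x - y) * (x - q * y) / D
  | 2, 0, 1, 1 => - (q * (1 - q) ^+ 2 * (1 + q) * x * (x - y) / D)
  | 2, 0, 0, 2 =>
      (1 - q ^+ 2) * x * (x + q * x - q * y - q ^+ 3 * y) / D
  | 1, 1, 2, 0 => - (q ^+ 4 * (1 + q) * (x - y) * y / D)
  | 1, 1, 1, 1 =>
      (- (q * x ^+ 2) + (1 + q) * (1 - q ^+ 2 + q ^+ 4) * x * y
       - q ^+ 4 * y ^+ 2) / D
  | 1, 1, 0, 2 => (1 + q) * x * (x - y) / D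
  | 0, 2, 2, 0 =>
      (1 - q ^+ 2) * (x + q ^+ 2 * x - q ^+ 2 * y - q ^+ 3 * y) * y / D
  | 0, 2, 1, 1 => q * (1 - q) ^+ 2 * (1 + q) * (x - y) * y / D
  | 0, 2, 0, 2 => (x - y) * (x - q * y) / D
  | _, _, _, _ => 0
  end.

(* A configuration s labels the basis vector of V_1 (x) ... (x) V_N whose      *)
(* factor in V_i is the (s i)-th one; operators are square matrices over       *)
(* configurations.                                                             *)
Definition config (N : nat) : finType := {ffun 'I_N -> 'I_3}.

Definition operator (F : fieldType) (N : nat) := 'M[F]_#|config N|.

Definition entry (F : fieldType) (N : nat) (A : operator F N)
    (s t : config N) : F := A (enum_rank s) (enum_rank t).

(* M acting on V_i, tensored with the identity on the other factors. *)
Definition local (F : fieldType) (N : nat) (i : 'I_N) (M : 'M[F]_3) :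
    operator F N :=
  \matrix_(a, b)
    let s : config N := enum_val a in
    let t : config N := enum_val b in
    M (s i) (t i) *+ [forall j : 'I_N, (j != i) ==> (s j == t j)].

Definition diag3 (F : fieldType) (a b c : F) : 'M[F]_3 :=
  diag_mx (\row_(j < 3) [:: a; b; c]`_j).

(* The superscripts of the local matrices. *)
Definition white : bool := false.
Definition black : bool := true.

Section LocalMatrices.
Context {F : fieldType} {N : nat}.
Implicit Types (q z : F) (x : 'I_N -> F) (i j : 'I_N) (u v : bool).

Definition dmat q x i z : operator F N :=
  local i (diag3 1
    ((x i - z) / (x i - q ^+ 2 * z))
    ((x i - z) * (x i - q * z)
       / ((x i - q ^+ 2 * z) * (x i - q ^+ 3 * z)))).

Definition dmat_w q x i z : operator F N :=
  local i (diag3 1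
    ((q * x i - z) * (x i - q ^+ 2 * z) / ((1 + q) * (x i - z)))
    ((x i - q ^+ 3 * z) / (x i - q * z))).

Definition dmat_b q x i z : operator F N :=
  local i (diag3 1
    ((1 + q) / (q * x i - z))
    ((x i - q ^+ 2 * z) / (x i - z))).

Definition dmat_bw q x i z : operator F N :=
  local i (diag3 1
    ((x i - q ^+ 2 * z) / (x i - z))
    ((x i - q ^+ 2 * z) * (x i - q ^+ 3 * z)
       / ((x i - z) * (x i - q * z)))).

Definition dmat1 u q x i z : operator F N :=
  if u == black then dmat_b q x i z else dmat_w q x i z.

Definition emat_w q x i z : operator F N :=
  ((1 - q ^+ 2) * z / (x i - q ^+ 2 * z)) *: local i (delta_mx 1 0).

Definition emat_b q x i z : operator F N :=
  (q * (1 - q) ^+ 2 * (1 + q) * (x i - z) * z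
     / ((x i - q ^+ 2 * z) * (x i - q ^+ 3 * z))) *: local i (delta_mx 2 1).

Definition emat_bw q x i z : operator F N :=
  ((1 - q ^+ 2) * (x i + q ^+ 2 * x i - q ^+ 2 * z - q ^+ 3 * z) * z
     / ((x i - q ^+ 2 * z) * (x i - q ^+ 3 * z))) *: local i (delta_mx 2 0).

Definition emat1 u q x i z : operator F N :=
  if u == black then emat_b q x i z else emat_w q x i z.

Definition emat_w_w q x i j z : operator F N :=
  ((x i * x j + q ^+ 2 * x i * x j - q ^+ 2 * x i * z - q ^+ 2 * x j * z)
     / ((1 - q ^+ 2) * z)) *: (emat_w q x i z * emat_w q x j z).

Definition emat_b_w q x i j z : operator F N :=
  ((x i * x j + q ^+ 2 * x i * x j - q ^+ 2 * x i * z - q ^+ 3 * x j * z)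
     / (q * (1 - q) * (x i - x j) * z)) *: (emat_b q x i z * emat_w q x j z).

Definition emat_b_b q x i j z : operator F N :=
  ((1 + q) *
   (x i * x j + q ^+ 2 * x i * x j - q ^+ 3 * x i * z - q ^+ 3 * x j * z)
     / (q * (1 - q) * (x i - q * x j) * (x j - q * x i) * z))
  *: (emat_b q x i z * emat_b q x j z).

Definition emat2 u v q x i j z : operator F N :=
  if u == black then
    if v == black then emat_b_b q x i j z else emat_b_w q x i j z
  else
    if v == black then emat_b_w q x j i z else emat_w_w q x i j z.

Definition Gamma0 q x z : operator F N := \prod_(i < N) dmat q x i z.

Definition Gamma1 q x z : operator F N :=
  \sum_(u : bool) \sum_(i < N)
    emat1 u q x i z *
    \prod_(j < N | j != i) (dmat q x j z * dmat1 u q x j (x i)).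

Definition Gamma2 q x z : operator F N :=
  \sum_(i < N)
    emat_bw q x i z *
    \prod_(j < N | j != i) (dmat q x j z * dmat_bw q x j (x i))
  + \sum_(u : bool) \sum_(v : bool)
    \sum_(i < N) \sum_(j < N | (i < j)%N)
      emat2 u v q x i j z *
      \prod_(k < N | (k != i) && (k != j))
        (dmat q x k z * dmat1 u q x k (x i) * dmat1 v q x k (x j)).

Definition Gamma (k : 'I_3) q x z : operator F N :=
  match nat_of_ord k with
  | 0 => Gamma0 q x z
  | 1 => Gamma1 q x z
  | _ => Gamma2 q x z
  end.

End LocalMatrices.

(* Main.v *)
Require Import Defs.
From mathcomp Require Import all_boot all_order all_fingroup all_algebra.
From mathcomp Require Import ring.

Set Implicit Arguments.
Unset Strict Implicit.
Unset Printing Implicit Defensive.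

Import GRing.Theory.
Local Open Scope ring_scope.

(** The matrix entry of a column operator between two configurations [t]
    (initial, a column) and [s] (final, a row) is a single product: the sites
    where [s] and [t] differ carry an amplitude, and every other site carries a
    diagonal weight times one twisting factor for each site that changes
    ([entry_Gamma]).  This expression, [loc], depends on the multiset of triples
    (parameter, final state, initial state) only, which gives the invariance
    under permutations.

    For the exchange relations, an entry of [Gamma k z * Gamma l y] is a sum over
    the intermediate configurations lying between [t] and [s].  The diagonal
    weights of the sites where [s] and [t] agree do not depend on the intermediate
    configuration, because the twisting factor of a change 0 -> 2 is the product
    of those of the changes 0 -> 1 and 1 -> 2; they come out as a common factor,
    symmetric in [z] and [y] ([entry_product]).  What remains is a sum over the
    sites that change, and since each operator raises the sum of the states by its
    index, at most four steps are made in total.  The relation is thus reduced to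
    finitely many identities between rational functions ([pairsum_exchange]).

    The number of these identities is cut down by treating both colours at once: a
    change 0 -> 1 (white) at a site with parameter [x] behaves, up to factors
    common to all the terms, as a point [x], and a change 1 -> 2 (black) as a point
    [x / q] ([amp1E], [dval_initial], [dval_final], [crossE], [amp2E]).  Two points
    [a] and [b], of which [a] is moved first, interact through
    [phi a b = (q a - b) (a - q^2 b) / (a - b)].  Changes 0 -> 2 would be pairs of
    points [x], [x / q], but the common factor could then vanish, so they are kept
    apart.  The remaining identities involve at most four points; those of total
    degree four are symmetries in [z] and [y], which become polynomial identities
    once the denominators are cleared. *)

(** * Scalar weights *)

Lemma neq0_opp (F : fieldType) (a b : F) : b != 0 -> a = - b -> a != 0.
Proof. by move=> ? ->; rewrite oppr_eq0. Qed.

(** Discharges the side conditions of [field]: each of them is, up to sign, one of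
    the hypotheses. *)
Ltac nz := repeat match goal with
  | |- is_true (_ && _) => apply/andP; split
  | |- _ /\ _ => split
  | |- is_true true => exact isT
  end;
  try assumption;
  try match goal with
  | H : is_true (?b != 0) |- is_true (?a != 0) =>
      solve [ (suff -> : a = b by []); ring | apply: (neq0_opp H); ring ]
  end.

Section Scalars.
Variables (F : fieldType) (q : F).
Implicit Types (x y z w : F) (u v : bool).

(** Diagonal weights: [dval z x a] is the entry of [d(z)] at state [a] of a site with
    parameter [x]. *)
Definition dval z x (a : nat) : F :=
  [:: 1; (x - z) / (x - q ^+ 2 * z);
      (x - z) * (x - q * z) / ((x - q ^+ 2 * z) * (x - q ^+ 3 * z))]`_a.

(** Twisting factors of a site with parameter [x] in state [a], due to a change at
    a site with parameter [z]; [w], [b] and [bw] stand for the superscripts white,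
    black and black-white, that is for the changes 0 -> 1, 1 -> 2 and 0 -> 2. *)
Definition twist_w z x (a : nat) : F :=
  [:: 1; (q * x - z) * (x - q ^+ 2 * z) / ((1 + q) * (x - z));
      (x - q ^+ 3 * z) / (x - q * z)]`_a.

Definition twist_b z x (a : nat) : F :=
  [:: 1; (1 + q) / (q * x - z); (x - q ^+ 2 * z) / (x - z)]`_a.

Definition twist_bw z x (a : nat) : F :=
  [:: 1; (x - q ^+ 2 * z) / (x - z);
      (x - q ^+ 2 * z) * (x - q ^+ 3 * z) / ((x - z) * (x - q * z))]`_a.

(** Amplitudes: the coefficients of the local matrices that change one site, and
    below those of the products that change two sites. *)
Definition amp_w z x : F := (1 - q ^+ 2) * z / (x - q ^+ 2 * z).

Definition amp_b z x : F :=
  q * (1 - q) ^+ 2 * (1 + q) * (x - z) * z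
     / ((x - q ^+ 2 * z) * (x - q ^+ 3 * z)).

Definition amp_bw z x : F :=
  (1 - q ^+ 2) * (x + q ^+ 2 * x - q ^+ 2 * z - q ^+ 3 * z) * z
     / ((x - q ^+ 2 * z) * (x - q ^+ 3 * z)).

Definition amp_w_w z x y : F :=
  (x * y + q ^+ 2 * x * y - q ^+ 2 * x * z - q ^+ 2 * y * z)
     / ((1 - q ^+ 2) * z) * (amp_w z x * amp_w z y).

Definition amp_b_w z x y : F :=
  (x * y + q ^+ 2 * x * y - q ^+ 2 * x * z - q ^+ 3 * y * z)
     / (q * (1 - q) * (x - y) * z) * (amp_b z x * amp_w z y).

Definition amp_b_b z x y : F :=
  (1 + q) *
   (x * y + q ^+ 2 * x * y - q ^+ 3 * x * z - q ^+ 3 * y * z)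
     / (q * (1 - q) * (x - q * y) * (y - q * x) * z)
  * (amp_b z x * amp_b z y).

(** The same scalars for a variable colour, [true] standing for black. *)
Definition twist1 u := if u then twist_b else twist_w.
Definition amp1 u := if u then amp_b else amp_w.
Definition amp2 u v z x y :=
  if u then if v then amp_b_b z x y else amp_b_w z x y
  else if v then amp_b_w z y x else amp_w_w z x y.

(** Two distinct sites have [apart] parameters, and a spectral parameter is
    [regular] at every site: these are the nonvanishing conditions in use. *)
Definition apart x y := [/\ x - y != 0, x - q * y != 0 & y - q * x != 0].
Definition regular z x := x - q ^+ 2 * z != 0 /\ x - q ^+ 3 * z != 0.

(** The point attached to a single step of colour [u] at parameter [x]. *)
Definition point u x := if u then x / q else x.

(** Interaction of two points [a] and [b], of which [a] is moved first. *)
Definition phi_num a b : F := (q * a - b) * (a - q ^+ 2 * b).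
Definition phi a b : F := phi_num a b / (a - b).

(** Numerator of the amplitude for moving the points [a] and [b] at once. *)
Definition pair_poly z a b : F := (1 + q ^+ 2) * a * b - q ^+ 2 * z * (a + b).

(** Factors by which the weights of coloured steps differ from those of their
    points; they do not depend on the order in which the steps are made. *)
Definition pair_norm u v x y : F :=
  if u then if v then (1 + q) * q / ((x - q * y) * (y - q * x)) else (x - y)^-1
  else if v then (y - x)^-1 else (1 + q)^-1.
Definition site_norm u z x : F :=
  if u then q * (x - z) / ((x - q ^+ 2 * z) * (x - q ^+ 3 * z))
  else (x - q ^+ 2 * z)^-1.
Definition color_norm u : F := if u then (1 - q) ^+ 2 * (1 + q) else 1 - q ^+ 2.

Hypothesis gq : generic_q q.

Lemma point_apart u v x y : apart x y -> point u x - point v y != 0.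
Proof.
case: gq => q0 _ _ [h1 h2 h3]; have qV : q^-1 != 0 by rewrite invr_neq0.
case: u v => [] [] //=.
- by rewrite -mulrBl mulf_neq0.
- have -> : x / q - y = (x - q * y) / q by field; nz.
  by rewrite mulf_neq0.
- have -> : x - y / q = - ((y - q * x) / q) by field; nz.
  by rewrite oppr_eq0 mulf_neq0.
Qed.

Lemma amp1E u z x : regular z x -> amp1 u z x = color_norm u * z * site_norm u z x.
Proof.
case: gq => ? ? ? [? ?].
by case: u; rewrite /= /amp_b /amp_w; field; nz.
Qed.

(** The states before and after a step of colour [u] are [u] and [u.+1], the boolean
    [u] being read as 0 or 1. *)
Lemma dval_initial u z x : regular z x ->
  dval z x u = (point u x - q ^+ 2 * z) * site_norm u z x.
Proof.
case: gq => ? ? ? [? ?].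
by case: u; rewrite /dval /=; field; nz.
Qed.

Lemma dval_final u z x : regular z x ->
  dval z x u.+1 = (point u x - z) * site_norm u z x.
Proof.
case: gq => ? ? ? [? ?].
by case: u; rewrite /dval /=; field; nz.
Qed.

Lemma pair_normC u v x y : pair_norm u v x y = pair_norm v u y x.
Proof. by case: u; case: v => //=; rewrite [_ * (x - _)]mulrC. Qed.

Lemma amp2C u v z x y : amp2 u v z x y = amp2 v u z y x.
Proof.
by case: u; case: v; rewrite //= /amp_b_b /amp_w_w; congr (_ / _ * _); ring.
Qed.

(** The steps at [x] and [y] are made by different operators, the one at [x] first:
    it sees the site [y] in its initial state, and the step at [y] sees the site
    [x] in its final state. *)
Lemma crossE u v x y : apart x y ->
  twist1 u x y v * twist1 v y x u.+1 =
  pair_norm u v x y * phi (point u x) (point v y).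
Proof.
move=> h; have pd := @point_apart u v x y h.
case: gq h => ? ? ? [? ? ?]; move: pd.
case: u; case: v; rewrite /= /phi /phi_num /twist_b /twist_w /= => ?; field; nz.
Qed.

Lemma sqr_neq1 : 1 - q ^+ 2 != 0.
Proof.
case: gq => ? ? ?; have -> : 1 - q ^+ 2 = (1 - q) * (1 + q) by ring.
by rewrite mulf_neq0.
Qed.

Lemma amp2E u v z x y : apart x y -> regular z x -> regular z y -> z != 0 ->
  amp2 u v z x y =
  pair_norm u v x y * pair_poly z (point u x) (point v y) / ((1 - q) * z)
  * (amp1 u z x * amp1 v z y).
Proof.
have := sqr_neq1; case: gq => ? ? ? ? [? ? ?] [? ?] [? ?] ?.
case: u; case: v; rewrite /= /amp_b_b /amp_b_w /amp_w_w /pair_poly.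
- by congr (_ * _); field; nz.
- by congr (_ * _); field; nz.
- by rewrite [amp_w _ _ * _]mulrC; congr (_ * _); field; nz.
- by congr (_ * _); field; nz.
Qed.
End Scalars.

(** * Exchange relations for the sites that change *)

Section PointIdentities.
Variables (F : fieldType) (q : F).
Implicit Types (a b c d x y z : F).
Hypothesis gq : generic_q q.

(** The vertex weights, indexed by natural numbers. *)
Definition weight x y (i j k l : nat) : F :=
  IKweight q x y (inord i) (inord j) (inord k) (inord l).

(** Amplitude of an operator of parameter [z] for moving the points [a] and [b] at once,
    without its factor [z] and with it. *)
Definition pair_scal z a b : F := pair_poly q z a b / (1 - q).
Definition pair_amp z a b : F := z * pair_scal z a b.

(** In the rest of this part, [ptskl z y] is the sum over the ways to move [k] of
    the given points by an operator of parameter [z], after the [l] other ones by an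
    operator of parameter [y].  A point [a] contributes [a - q^2 y] if it
    waits for the second operator, and [a - z] if it was moved by the first one. *)
Definition pts10 z y a := z * (a - q ^+ 2 * y).
Definition pts01 z y a := y * (a - z).

Definition pts20 z y a b := pair_amp z a b * ((a - q ^+ 2 * y) * (b - q ^+ 2 * y)).
Definition pts11 z y a b := z * y * ((a - q ^+ 2 * y) * (b - z) * phi q b a
  + (b - q ^+ 2 * y) * (a - z) * phi q a b).
Definition pts02 z y a b := pair_amp y a b * ((a - z) * (b - z)).

Definition pts21_term z y a b c := pair_amp z a b * y *
  ((a - q ^+ 2 * y) * (b - q ^+ 2 * y) * (c - z)) * (phi q c a * phi q c b).
Definition pts12_term z y a b c := z * pair_amp y b c *
  ((a - q ^+ 2 * y) * (b - z) * (c - z)) * (phi q b a * phi q c a).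
Definition pts21 z y a b c :=
  pts21_term z y a b c + pts21_term z y a c b + pts21_term z y b c a.
Definition pts12 z y a b c :=
  pts12_term z y a b c + pts12_term z y b a c + pts12_term z y c a b.

Definition pts22_term z y a b c d := pair_amp z a b * pair_amp y c d *
  ((a - q ^+ 2 * y) * (b - q ^+ 2 * y) * (c - z) * (d - z)) *
  (phi q c a * phi q c b * phi q d a * phi q d b).
Definition pts22 z y a b c d :=
  pts22_term z y a b c d + pts22_term z y a c b d + pts22_term z y a d b c +
  pts22_term z y b c a d + pts22_term z y b d a c + pts22_term z y c d a b.

(** The same sums for a jump, i.e. a change 0 -> 2 at a site with parameter [x]: the
    jump is made by the operator of parameter [z] (20), by that of parameter [y]
    (02), or split into a white step followed by a black one (11). *)
Definition jmp20 z y x := amp_bw q z x.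
Definition jmp11 z y x := amp_w q y x * amp_b q z x.
Definition jmp02 z y x := amp_bw q y x * dval q z x 2.

(** Interaction of a jump at [x] with a point [a], up to a common factor: the jump is
    split and the point is moved with its first or second half; or the jump is
    not split and comes after or before the point. *)
Definition split_step_first x a := (q * a - x)^-1.
Definition split_step_second x a := (x - a)^-1.
Definition step_then_jump x a := (q ^+ 2 * x - a) / (x - a).
Definition jump_then_step x a := (x - q ^+ 3 * a) / (x - q * a).

(** Sums for a jump at [x] together with one or two points. *)
Definition mix21 z y x a :=
  pair_scal z (x / q) a * jmp11 z y x * (a - q ^+ 2 * y) * split_step_second x a
 + y * amp_bw q z x * (a - z) * step_then_jump x a.
Definition mix12 z y x a :=
  pair_scal y x a * jmp11 z y x * (a - z) * split_step_first x a
 + z * jmp02 z y x * (a - q ^+ 2 * y) * jump_then_step x a.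

Definition mix22_term z y x a b :=
  pair_scal y x a * pair_scal z (x / q) b * jmp11 z y x *
  ((b - q ^+ 2 * y) * (a - z)) *
  (split_step_first x a * split_step_second x b * phi q a b).
Definition mix22 z y x a b :=
  mix22_term z y x a b + mix22_term z y x b a +
  pair_amp y a b * amp_bw q z x * ((a - z) * (b - z)) *
    (step_then_jump x a * step_then_jump x b) +
  pair_amp z a b * jmp02 z y x * ((a - q ^+ 2 * y) * (b - q ^+ 2 * y)) *
    (jump_then_step x a * jump_then_step x b).

(** Sum for two jumps, which are both split or made by different operators. *)
Definition jmps22 z y x1 x2 :=
  amp_w_w q y x1 x2 * amp_b_b q z x1 x2 +
  amp_bw q y x1 * amp_bw q z x2 * (dval q z x1 2 * twist_bw q x2 x1 2) +
  amp_bw q y x2 * amp_bw q z x1 * (dval q z x2 2 * twist_bw q x1 x2 2).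

Variables (z y : F).

Lemma phiC a b : phi q b a = (q * b - a) * (q ^+ 2 * a - b) / (a - b).
Proof. by rewrite /phi /phi_num -[b - a]opprB invrN mulrN -mulNr -mulrN opprB. Qed.

Hypothesis rW : regular q z y.
Notation W i j k l := (weight y z i%N j%N k%N l%N).
Ltac evW := rewrite /weight /IKweight !inordK //.

(** The exchange relations for total degree at most three. *)
Lemma jmp20_exchange x :
   regular q z x -> regular q y x ->
  jmp20 z y x = W 2 0 2 0 * jmp02 y z x +
    W 1 1 2 0 * jmp11 y z x +
    W 0 2 2 0 * jmp20 y z x.
Proof.
case: gq rW  => ? ? ? [? ?] [? ?] [? ?].
evW; rewrite /jmp20 /jmp11 /jmp02 /amp_bw /amp_w /amp_b /dval /=.
field; nz.
Qed.

Lemma jmp11_exchange x :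
   regular q z x -> regular q y x ->
  jmp11 z y x = W 2 0 1 1 * jmp02 y z x +
    W 1 1 1 1 * jmp11 y z x +
    W 0 2 1 1 * jmp20 y z x.
Proof.
case: gq rW  => ? ? ? [? ?] [? ?] [? ?].
evW; rewrite /jmp20 /jmp11 /jmp02 /amp_bw /amp_w /amp_b /dval /=.
field; nz.
Qed.

Lemma jmp02_exchange x :
   regular q z x -> regular q y x ->
  jmp02 z y x = W 2 0 0 2 * jmp02 y z x +
    W 1 1 0 2 * jmp11 y z x +
    W 0 2 0 2 * jmp20 y z x.
Proof.
case: gq rW  => ? ? ? [? ?] [? ?] [? ?].
evW; rewrite /jmp20 /jmp11 /jmp02 /amp_bw /amp_w /amp_b /dval /=.
field; nz.
Qed.

Lemma pts10_exchange a :
  pts10 z y a = W 1 0 1 0 * pts01 y z a + W 0 1 1 0 * pts10 y z a.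
Proof.
case: gq rW  => ? ? ? [? ?].
evW; rewrite /pts10 /pts01; field; nz.
Qed.

Lemma pts01_exchange a :
  pts01 z y a = W 1 0 0 1 * pts01 y z a + W 0 1 0 1 * pts10 y z a.
Proof.
case: gq rW  => ? ? ? [? ?].
evW; rewrite /pts10 /pts01; field; nz.
Qed.

Lemma pts20_exchange a b : a - b != 0 ->
  pts20 z y a b = W 2 0 2 0 * pts02 y z a b +
    W 1 1 2 0 * pts11 y z a b +
    W 0 2 2 0 * pts20 y z a b.
Proof.
case: gq rW  => ? ? ? [? ?] ?.
evW; rewrite /pts20 /pts11 /pts02 (phiC a b) /pair_amp /pair_scal /phi /phi_num
  /pair_poly.
field; nz.
Qed.

Lemma pts11_exchange a b : a - b != 0 ->
  pts11 z y a b = W 2 0 1 1 * pts02 y z a b +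
    W 1 1 1 1 * pts11 y z a b +
    W 0 2 1 1 * pts20 y z a b.
Proof.
case: gq rW  => ? ? ? [? ?] ?.
evW; rewrite /pts20 /pts11 /pts02 (phiC a b) /pair_amp /pair_scal /phi /phi_num
  /pair_poly.
field; nz.
Qed.

Lemma pts02_exchange a b : a - b != 0 ->
  pts02 z y a b = W 2 0 0 2 * pts02 y z a b +
    W 1 1 0 2 * pts11 y z a b +
    W 0 2 0 2 * pts20 y z a b.
Proof.
case: gq rW  => ? ? ? [? ?] ?.
evW; rewrite /pts20 /pts11 /pts02 (phiC a b) /pair_amp /pair_scal /phi /phi_num
  /pair_poly.
field; nz.
Qed.

Lemma pts21_exchange a b c : a - b != 0 -> a - c != 0 -> b - c != 0 ->
  pts21 z y a b c = W 2 1 2 1 * pts12 y z a b c +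
    W 1 2 2 1 * pts21 y z a b c.
Proof.
case: gq rW  => ? ? ? [? ?] ? ? ?.
evW; rewrite /pts21 /pts12 /pts21_term /pts12_term (phiC a b) (phiC a c) (phiC b c)
  /pair_amp /pair_scal /phi /phi_num /pair_poly.
field; nz.
Qed.

Lemma pts12_exchange a b c : a - b != 0 -> a - c != 0 -> b - c != 0 ->
  pts12 z y a b c = W 2 1 1 2 * pts12 y z a b c +
    W 1 2 1 2 * pts21 y z a b c.
Proof.
case: gq rW  => ? ? ? [? ?] ? ? ?.
evW; rewrite /pts21 /pts12 /pts21_term /pts12_term (phiC a b) (phiC a c) (phiC b c)
  /pair_amp /pair_scal /phi /phi_num /pair_poly.
field; nz.
Qed.

Lemma mix21_exchange x a : x - a != 0 -> q * a - x != 0 -> x - q * a != 0 ->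
  regular q z x -> regular q y x ->
  mix21 z y x a = W 2 1 2 1 * mix12 y z x a +
    W 1 2 2 1 * mix21 y z x a.
Proof.
case: gq rW  => ? ? ? [? ?] ? ? ? [? ?] [? ?].
evW; rewrite /mix21 /mix12 /jmp11 /jmp02 /pair_amp /pair_scal /split_step_first
  /split_step_second /step_then_jump /jump_then_step /amp_bw /amp_w_w /amp_b_b /amp_w
    /amp_b /dval /phi /phi_num /pair_poly /=.
field; nz.
Qed.

Lemma mix12_exchange x a : x - a != 0 -> q * a - x != 0 -> x - q * a != 0 ->
  regular q z x -> regular q y x ->
  mix12 z y x a = W 2 1 1 2 * mix12 y z x a +
    W 1 2 1 2 * mix21 y z x a.
Proof.
case: gq rW  => ? ? ? [? ?] ? ? ? [? ?] [? ?].
evW; rewrite /mix21 /mix12 /jmp11 /jmp02 /pair_amp /pair_scal /split_step_first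
  /split_step_second /step_then_jump /jump_then_step /amp_bw /amp_w_w /amp_b_b /amp_w
    /amp_b /dval /phi /phi_num /pair_poly /=.
field; nz.
Qed.
End PointIdentities.

(** * Symmetry of the sums of total degree four *)

Section Symmetry.
Variables (F : fieldType) (q : F).
Implicit Types (a b c d x y z : F).
Hypothesis gq : generic_q q.

Lemma six_fractions a b c d (X1 X2 X3 X4 X5 X6 : F) :
  a - b != 0 -> a - c != 0 -> a - d != 0 -> b - c != 0 -> b - d != 0 -> c - d != 0 ->
  X1 / ((c - a) * (c - b) * (d - a) * (d - b)) +
  X2 / ((b - a) * (b - c) * (d - a) * (d - c)) +
  X3 / ((b - a) * (b - d) * (c - a) * (c - d)) +
  X4 / ((a - b) * (a - c) * (d - b) * (d - c)) +
  X5 / ((a - b) * (a - d) * (c - b) * (c - d)) +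
  X6 / ((a - c) * (a - d) * (b - c) * (b - d)) =
  (X1 * ((a - b) * (c - d)) - X2 * ((a - c) * (b - d)) + X3 * ((a - d) * (b - c))
   + X4 * ((b - c) * (a - d)) - X5 * ((b - d) * (a - c)) + X6 * ((c - d) * (a - b)))
  / ((a - b) * (a - c) * (a - d) * (b - c) * (b - d) * (c - d)).
Proof.
move=> ? ? ? ? ? ?.
rewrite -[c - a]opprB -[d - a]opprB -[d - b]opprB -[c - b]opprB -[b - a]opprB
  -[d - c]opprB !(mulNr, mulrN, opprK).
by field; nz; rewrite ?oppr_eq0 !mulf_neq0.
Qed.

(** The numerator of a term of [pts22]. *)
Definition pts22_num z y a b c d : F := pair_poly q z a b * pair_poly q y c d *
  ((a - q ^+ 2 * y) * (b - q ^+ 2 * y) * (c - z) * (d - z)) *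
  (phi_num q c a * phi_num q c b * phi_num q d a * phi_num q d b).

Lemma pts22_termE z y a b c d : pts22_term q z y a b c d =
  z * y / (1 - q) ^+ 2 *
  (pts22_num z y a b c d / ((c - a) * (c - b) * (d - a) * (d - b))).
Proof.
rewrite /pts22_term /pts22_num /pair_amp /pair_scal /phi expr2 !invfM; ring.
Qed.

(** The alternating sum over the six ways to choose two of four points, obtained
    by multiplying [pts22] by the Vandermonde product. *)
Lemma pts22_num_sym z y a b c d :
  let alternating z y :=
    pts22_num z y a b c d * ((a - b) * (c - d)) -
    pts22_num z y a c b d * ((a - c) * (b - d)) +
    pts22_num z y a d b c * ((a - d) * (b - c)) +
    pts22_num z y b c a d * ((b - c) * (a - d)) -
    pts22_num z y b d a c * ((b - d) * (a - c)) +
    pts22_num z y c d a b * ((c - d) * (a - b)) in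
  alternating z y = alternating y z.
Proof. by rewrite /= /pts22_num /pair_poly /phi_num; ring. Qed.

Lemma pts22C z y a b c d :
  a - b != 0 -> a - c != 0 -> a - d != 0 -> b - c != 0 -> b - d != 0 -> c - d != 0 ->
  pts22 q z y a b c d = pts22 q y z a b c d.
Proof.
move=> *; rewrite /pts22 !pts22_termE -!mulrDr !six_fractions // pts22_num_sym.
by rewrite [z * y]mulrC.
Qed.

(** Factors of the amplitudes of jumps, split or not. *)
Definition denom z x : F := (x - q ^+ 2 * z) * (x - q ^+ 3 * z).
Definition jump_poly z x : F := x + q ^+ 2 * x - q ^+ 2 * z - q ^+ 3 * z.
Definition mixed_poly z x b : F := (1 + q ^+ 2) * x * b - q ^+ 2 * z * (x + q * b).
Definition black_poly z a b : F := (1 + q ^+ 2) * a * b - q ^+ 3 * z * (a + b).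

Lemma denom_neq0 z x : regular q z x -> denom z x != 0.
Proof. by case=> ? ?; rewrite mulf_neq0. Qed.

Lemma amp_wE z x : regular q z x ->
  amp_w q z x = (1 - q ^+ 2) * z * (x - q ^+ 3 * z) / denom z x.
Proof. by case=> ? ?; rewrite /amp_w /denom; field; nz. Qed.

Lemma amp_bE z x : amp_b q z x = q * (1 - q) ^+ 2 * (1 + q) * (x - z) * z / denom z x.
Proof. by []. Qed.

Lemma amp_bwE z x : amp_bw q z x = (1 - q ^+ 2) * jump_poly z x * z / denom z x.
Proof. by []. Qed.

Lemma dval2E z x : dval q z x 2 = (x - z) * (x - q * z) / denom z x.
Proof. by []. Qed.

Lemma pair_scalE z x b : pair_scal q z (x / q) b = mixed_poly z x b / (q * (1 - q)).
Proof.
by case: gq => ? ? ?; rewrite /pair_scal /pair_poly /mixed_poly; field; nz.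
Qed.

Lemma four_fractions x a b (X1 X2 X3 X4 : F) :
  x - a != 0 -> q * a - x != 0 -> x - q * a != 0 ->
  x - b != 0 -> q * b - x != 0 -> x - q * b != 0 -> a - b != 0 ->
  X1 / ((q * a - x) * (x - b) * (a - b)) + X2 / ((q * b - x) * (x - a) * (b - a)) +
  X3 / ((x - a) * (x - b)) + X4 / ((x - q * a) * (x - q * b)) =
  (X2 * ((x - b) * (x - q * a)) - X1 * ((x - a) * (x - q * b)) +
   X3 * ((x - q * a) * (x - q * b) * (a - b)) + X4 * ((x - a) * (x - b) * (a - b)))
  / ((x - a) * (x - b) * (x - q * a) * (x - q * b) * (a - b)).
Proof.
move=> ? ? ? ? ? ? ?.
rewrite -[q * a - x]opprB -[q * b - x]opprB -[b - a]opprB !(mulNr, mulrN, opprK).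
by field; nz; rewrite ?oppr_eq0 !mulf_neq0.
Qed.

(** Numerators of the terms of [mix22]: the jump is split, comes after both points, or
    comes before both. *)
Definition mix22_split z y x a b : F :=
  (1 - q ^+ 2) * (pair_poly q y x a * mixed_poly z x b * ((x - z) * (x - q ^+ 3 * y))
    * ((b - q ^+ 2 * y) * (a - z)) * phi_num q a b).
Definition mix22_after z y x a b : F :=
  pair_poly q y a b * jump_poly z x * denom y x * ((a - z) * (b - z))
    * ((q ^+ 2 * x - a) * (q ^+ 2 * x - b)).
Definition mix22_before z y x a b : F :=
  pair_poly q z a b * jump_poly y x * ((x - z) * (x - q * z))
    * ((a - q ^+ 2 * y) * (b - q ^+ 2 * y)) * ((x - q ^+ 3 * a) * (x - q ^+ 3 * b)).

Lemma mix22_num_sym z y x a b :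
  let num z y :=
    mix22_split z y x b a * ((x - b) * (x - q * a)) -
    mix22_split z y x a b * ((x - a) * (x - q * b)) +
    mix22_after z y x a b * ((x - q * a) * (x - q * b) * (a - b)) +
    mix22_before z y x a b * ((x - a) * (x - b) * (a - b)) in
  num z y = num y z.
Proof.
rewrite /= /mix22_split /mix22_after /mix22_before /pair_poly /mixed_poly.
by rewrite /jump_poly /denom /phi_num; ring.
Qed.

Lemma mix22E z y x a b :
  x - a != 0 -> q * a - x != 0 -> x - q * a != 0 ->
  x - b != 0 -> q * b - x != 0 -> x - q * b != 0 -> a - b != 0 ->
  regular q z x -> regular q y x ->
  mix22 q z y x a b = z * y * (1 + q) / (denom z x * denom y x) *
   (mix22_split z y x a b / ((q * a - x) * (x - b) * (a - b)) +
    mix22_split z y x b a / ((q * b - x) * (x - a) * (b - a)) +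
    mix22_after z y x a b / ((x - a) * (x - b)) +
    mix22_before z y x a b / ((x - q * a) * (x - q * b))).
Proof.
move=> ? ? ? ? ? ? ? rz ry; have := (denom_neq0 rz, denom_neq0 ry) => -[? ?].
have [? ? ?] := gq; have ? : b - a != 0 by rewrite -oppr_eq0 opprB.
have splitE c d : q * c - x != 0 -> x - d != 0 -> c - d != 0 -> mix22_term q z y x c d =
    z * y * (1 + q) / (denom z x * denom y x) *
    (mix22_split z y x c d / ((q * c - x) * (x - d) * (c - d))).
  move=> ? ? ?; rewrite /mix22_term pair_scalE /pair_scal /jmp11 amp_wE // amp_bE.
  by rewrite /split_step_first /split_step_second /phi /mix22_split; field; nz.
rewrite /mix22 !splitE // 3![in RHS]mulrDr; congr (_ + _ + _ + _).
  rewrite amp_bwE /pair_amp /pair_scal /step_then_jump /mix22_after.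
  by field; nz.
rewrite /jmp02 amp_bwE dval2E /pair_amp /pair_scal /jump_then_step /mix22_before.
by field; nz.
Qed.

Lemma mix22C z y x a b :
  x - a != 0 -> q * a - x != 0 -> x - q * a != 0 ->
  x - b != 0 -> q * b - x != 0 -> x - q * b != 0 -> a - b != 0 ->
  regular q z x -> regular q y x -> mix22 q z y x a b = mix22 q y z x a b.
Proof.
move=> ? ? ? ? ? ? ? rz ry; rewrite !mix22E // !four_fractions // mix22_num_sym.
by rewrite [z * y]mulrC [denom z x * _]mulrC.
Qed.

(** Numerators of the terms of [jmps22]: both jumps are split, or none. *)
Definition jmps22_split z y a b : F :=
  q * (1 - q ^+ 2) ^+ 2 * pair_poly q y a b * black_poly z a b
  * ((a - z) * (b - z) * (a - q ^+ 3 * y) * (b - q ^+ 3 * y)).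
Definition jmps22_whole z y a b : F :=
  jump_poly y a * jump_poly z b * ((a - z) * (a - q * z)) * denom y b
  * ((a - q ^+ 2 * b) * (a - q ^+ 3 * b)).

Lemma jmps22_num_sym z y a b :
  let num z y := jmps22_split z y a b * (a - b)
    + jmps22_whole z y a b * (b - q * a) - jmps22_whole z y b a * (a - q * b) in
  num z y = num y z.
Proof.
rewrite /= /jmps22_split /jmps22_whole /pair_poly /black_poly /jump_poly /denom.
by ring.
Qed.

Lemma jmps22E z y a b : z != 0 -> y != 0 -> apart q a b ->
  regular q z a -> regular q z b -> regular q y a -> regular q y b ->
  jmps22 q z y a b =
  z * y * (1 - q ^+ 2) ^+ 2 / (denom z a * denom z b * (denom y a * denom y b)) *
  ((jmps22_split z y a b * (a - b)
    + jmps22_whole z y a b * (b - q * a) - jmps22_whole z y b a * (a - q * b))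
   / ((a - b) * (a - q * b) * (b - q * a))).
Proof.
move=> z0 y0 ab rza rzb rya ryb; have [? ? ?] := gq; have [? ? ?] := ab.
have ? := sqr_neq1 gq; have ? : b - a != 0 by rewrite -oppr_eq0 opprB.
have := (denom_neq0 rza, denom_neq0 rzb, denom_neq0 rya, denom_neq0 ryb) =>
  -[[[? ?] ?] ?].
have splitE : amp_w_w q y a b * amp_b_b q z a b =
    z * y * (1 - q ^+ 2) ^+ 2 / (denom z a * denom z b * (denom y a * denom y b)) *
    (jmps22_split z y a b / ((a - q * b) * (b - q * a))).
  have -> : amp_w_w q y a b =
      pair_poly q y a b / ((1 - q ^+ 2) * y) * (amp_w q y a * amp_w q y b).
    by rewrite /amp_w_w /pair_poly; congr (_ / _ * _); ring.
  have -> : amp_b_b q z a b = (1 + q) * black_poly z a b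
      / (q * (1 - q) * (a - q * b) * (b - q * a) * z) * (amp_b q z a * amp_b q z b).
    by rewrite /amp_b_b /black_poly; congr (_ / _ * _); ring.
  by rewrite !amp_wE // !amp_bE /jmps22_split; field; nz.
have wholeE c d : apart q c d ->
    denom z c != 0 -> denom z d != 0 -> denom y c != 0 -> denom y d != 0 ->
    amp_bw q y c * amp_bw q z d * (dval q z c 2 * twist_bw q d c 2) =
    z * y * (1 - q ^+ 2) ^+ 2 / (denom z c * denom z d * (denom y c * denom y d)) *
    (jmps22_whole z y c d / ((c - d) * (c - q * d))).
  move=> [? ? ?] ? ? ? ?.
  by rewrite !amp_bwE dval2E /twist_bw /= /jmps22_whole; field; nz.
have ba : apart q b a by split.
rewrite /jmps22 splitE !wholeE //.
by field; nz.
Qed.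

Lemma jmps22C z y a b : z != 0 -> y != 0 -> apart q a b ->
  regular q z a -> regular q z b -> regular q y a -> regular q y b ->
  jmps22 q z y a b = jmps22 q y z a b.
Proof.
move=> *; rewrite !jmps22E // jmps22_num_sym.
by rewrite [z * y]mulrC [denom z a * denom z b * _]mulrC.
Qed.
End Symmetry.

(** * Operators of tensor product form *)

Section TensorOperators.
Variables (F : fieldType) (N : nat).
Implicit Types (M : 'I_N -> 'M[F]_3) (A B : 'M[F]_3) (s t : config N) (i j k : 'I_N).

(** The operator acting by [M i] on each factor [V_i]. *)
Definition tens M : operator F N :=
  \matrix_(a, b) \prod_i M i ((enum_val a : config N) i) ((enum_val b : config N) i).

Lemma entry_tens M s t : entry (tens M) s t = \prod_i M i (s i) (t i).
Proof. by rewrite /entry mxE !enum_rankK. Qed.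

Lemma configP s t : (forall i, s i = t i) -> s = t.
Proof. by move=> h; apply: (proj1 (@ffunP _ _ _ _)). Qed.

Lemma operatorP (A B : operator F N) :
  (forall s t, entry A s t = entry B s t) -> A = B.
Proof.
by move=> h; apply/matrixP=> a b; have := h (enum_val a) (enum_val b);
  rewrite /entry !enum_valK.
Qed.

Lemma entryM (A B : operator F N) s t :
  entry (A * B) s t = \sum_r entry A s r * entry B r t.
Proof.
rewrite /entry mxE (reindex (@enum_rank (config N))) //.
exact: onW_bij (@enum_rank_bij _).
Qed.

Lemma entryZ c (A : operator F N) s t : entry (c *: A) s t = c * entry A s t.
Proof. by rewrite /entry mxE. Qed.

Lemma entryD (A B : operator F N) s t :
  entry (A + B) s t = entry A s t + entry B s t.
Proof. by rewrite /entry mxE. Qed.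

Lemma entry_sum (I : Type) (r : seq I) (P : pred I) (A : I -> operator F N) s t :
  entry (\sum_(i <- r | P i) A i) s t = \sum_(i <- r | P i) entry (A i) s t.
Proof. by rewrite /entry summxE. Qed.

Lemma mulZop c (A B : operator F N) : (c *: A) * B = c *: (A * B).
Proof. exact/esym/scalemxAl. Qed.

Lemma mulopZ c (A B : operator F N) : A * (c *: B) = c *: (A * B).
Proof. exact/esym/scalemxAr. Qed.

Lemma eq_tens M M' : M =1 M' -> tens M = tens M'.
Proof.
by move=> eqM; apply: operatorP => s t; rewrite !entry_tens;
  under eq_bigr do rewrite eqM.
Qed.

Lemma tens_mul M M' : tens M * tens M' = tens (fun i => M i *m M' i).
Proof.
apply: operatorP => s t; rewrite entryM entry_tens.
under [RHS]eq_bigr do rewrite mxE.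
by rewrite bigA_distr_bigA; apply: eq_bigr => r _; rewrite !entry_tens -big_split.
Qed.

Lemma prod_bool (I : finType) (P b : pred I) :
  \prod_(i | P i) (b i)%:R = ([forall i, P i ==> b i])%:R :> F.
Proof.
case: forallP => [h | /forallP]; first by rewrite big1 // => i /(implyP (h i)) ->.
by rewrite negb_forall => /existsP[i]; rewrite negb_imply => /andP[Pi /negPf bi];
  rewrite (bigD1 i) //= bi mul0r.
Qed.

Lemma local_tens i A : local i A = tens (fun j => if j == i then A else 1%:M).
Proof.
apply: operatorP => s t; rewrite entry_tens /entry mxE !enum_rankK.
rewrite (bigD1 i) //= eqxx -mulr_natr -prod_bool; congr (_ * _).
by apply: eq_bigr => j /negPf ->; rewrite mxE.
Qed.

Lemma tens1 : tens (fun=> 1%:M) = 1.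
Proof.
apply: operatorP => s t; rewrite entry_tens.
under eq_bigr do rewrite mxE.
rewrite prod_bool /entry mxE (inj_eq enum_rank_inj); congr (_%:R); congr nat_of_bool.
apply/idP/eqP => [/forallP h|->]; last by apply/forallP => i; rewrite eqxx.
by apply: configP => i; apply/eqP/h.
Qed.

Lemma prod_local (r : seq 'I_N) (P : pred 'I_N) (A : 'I_N -> 'M[F]_3) : uniq r ->
  \prod_(i <- r | P i) local i (A i) =
  tens (fun i => if (i \in r) && P i then A i else 1%:M).
Proof.
elim: r => [|j r IH] /=; first by rewrite big_nil -tens1.
case/andP=> jr ur; rewrite big_cons IH //; case: ifP => Pj.
  rewrite local_tens tens_mul; apply: eq_tens => i; rewrite in_cons.
  by case: eqP => [->|_] /=; rewrite ?(negPf jr) ?Pj ?mulmx1 ?mul1mx.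
by apply: eq_tens => i; rewrite in_cons; case: eqP => [->|_] //=; rewrite Pj andbF.
Qed.

Lemma local_mul i A B : local i A * local i B = local i (A *m B).
Proof.
rewrite !local_tens tens_mul; apply: eq_tens => j; case: eqP => // _; exact: mulmx1.
Qed.

(** The diagonal matrix with entries [f 0], [f 1], [f 2]. *)
Definition dg (f : nat -> F) : 'M[F]_3 := diag_mx (\row_(j < 3) f j).

Lemma dgE f (i j : 'I_3) : dg f i j = f j * (i == j)%:R.
Proof. by rewrite !mxE mulr_natr; case: eqP => [->|]. Qed.

Lemma dg_mul f g : dg f *m dg g = dg (fun a => f a * g a).
Proof. by rewrite mulmx_diag; congr diag_mx; apply/rowP => j; rewrite !mxE. Qed.

(* One local matrix distinguished. *)

(** Entries of a product with one, then two, distinguished local matrices. *)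
Lemma entry_tens1 i A (f : 'I_N -> nat -> F) s t :
  entry (local i A * \prod_(j | j != i) local j (dg (f j))) s t =
  A (s i) (t i) * \prod_(j | j != i) (f j (t j) * (s j == t j)%:R).
Proof.
rewrite prod_local ?index_enum_uniq // local_tens tens_mul entry_tens (bigD1 i) //=.
rewrite eqxx andbF mulmx1; congr (_ * _); apply: eq_bigr => j ji.
by rewrite ji mem_index_enum (negPf ji) mul1mx dgE.
Qed.

Lemma entry_tens2 i j A B (f : 'I_N -> nat -> F) s t : i != j ->
  entry (local i A * local j B * \prod_(k | (k != i) && (k != j)) local k (dg
    (f k))) s t =
  A (s i) (t i) * B (s j) (t j) *
   \prod_(k | (k != i) && (k != j)) (f k (t k) * (s k == t k)%:R).
Proof.
move=> ij; have ji : j != i by rewrite eq_sym.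
rewrite prod_local ?index_enum_uniq // !local_tens !tens_mul entry_tens.
rewrite (bigD1 i) // (bigD1 j) //= mulrA !eqxx (negPf ij) (negPf ji).
rewrite !mem_index_enum ?andbF /= !mulmx1 mul1mx; congr (_ * _).
apply: eq_bigr => k /andP[ki kj].
by rewrite ki kj mem_index_enum (negPf ki) (negPf kj) !mul1mx dgE.
Qed.

End TensorOperators.

(** * The weight of a list of sites *)

Section Sites.
Variables (F : fieldType) (q : F).
Implicit Types (x z : F) (a k : nat) (u v : bool).

(** A site is described by its parameter, its final state and its initial state,
    in this order. *)
Definition site := (F * nat * nat)%type.
Implicit Types (p m : site) (R : seq site).

Definition moved p := p.1.2 != p.2.

(** Twisting factor due to [p] on a site with parameter [x] in state [a]; it is 1 if
    [p] does not change. *)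
Definition twist p x a : F :=
  match p.2, p.1.2 with
  | 0, 1 => twist_w q p.1.1 x a
  | 1, 2 => twist_b q p.1.1 x a
  | 0, 2 => twist_bw q p.1.1 x a
  | _, _ => 1
  end.

(** The changes by one, and the change 0 -> 2. *)
Definition single p := (p.2 < 2)%N && (p.1.2 == p.2.+1).
Definition double p := (p.2 == 0)%N && (p.1.2 == 2)%N.

(** The amplitude with which the operator of index [k] makes the changes of the
    list [R]; it vanishes unless these are at most two changes, of possible types,
    that raise the states by [k] in total.  The colour of a step is read off its
    initial state. *)
Definition amp k z R : F :=
  match R with
  | [::] => (k == 0)%:R
  | [:: p] =>
      if (k == 1)%N && single p then amp1 q (p.2 == 1)%N z p.1.1
      else if (k == 2)%N && double p then amp_bw q z p.1.1 else 0
  | [:: p; m] =>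
      if [&& k == 2, single p & single m]%N
      then amp2 q (p.2 == 1)%N (m.2 == 1)%N z p.1.1 m.1.1 else 0
  | _ => 0
  end.

(** The weight of a list of sites: the amplitude of those that change, times the
    diagonal and twisting factors of those that do not. *)
Definition loc k z R : F :=
  amp k z [seq p <- R | moved p] *
  \prod_(p <- R | ~~ moved p)
    (dval q z p.1.1 p.2 * \prod_(m <- R | moved m) twist m p.1.1 p.2).

Lemma amp_ge3 k z R : (2 < size R)%N -> amp k z R = 0.
Proof. by case: R => [|p [|m [|]]]. Qed.

Lemma amp_perm k z R R' : perm_eq R R' -> amp k z R = amp k z R'.
Proof.
move=> RR'; apply: (@catCA_perm_ind _ (fun T => amp k z R = amp k z T) _ _ _ RR') => //.
move=> T1 T2 T3 ->; case: T1 T2 => [|p T1] [|m T2] //.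
case: (posnP (size T1 + size T2 + size T3)) => [/eqP|pos].
  rewrite !addn_eq0 => /andP[/andP[]] /nilP-> /nilP-> /nilP-> /=.
  by rewrite [single m && _]andbC amp2C.
have size3 (p' m' : site) T T' :
  (0 < size T + size T' + size T3)%N -> (2 < size ((p' :: T) ++ (m' :: T') ++ T3))%N.
  by rewrite !size_cat !(addSn, addnS) addnA.
by rewrite !amp_ge3 ?size3 // [(size T2 + _)%N]addnC.
Qed.

Lemma loc_perm k z R R' : perm_eq R R' -> loc k z R = loc k z R'.
Proof.
move=> RR'; rewrite /loc (amp_perm _ _ (perm_filter _ RR')); congr (_ * _).
rewrite (perm_big _ RR'); apply: eq_bigr => p _; congr (_ * _).
exact: perm_big.
Qed.
End Sites.

(** * Matrix entries of the column operators *)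

Section Entries.
Variables (F : fieldType) (N : nat) (q : F) (x : 'I_N -> F).
Implicit Types (z : F) (s t : config N) (i j k : 'I_N) (u v : bool).

(** The sites of a pair of configurations, and the indices of those that change. *)
Definition site_of s t i : site F := (x i, s i : nat, t i : nat).
Definition sites s t : seq (site F) := [seq site_of s t i | i <- index_enum 'I_N].
Definition changed s t : seq 'I_N := [seq i <- index_enum 'I_N | s i != t i].

Lemma moved_site s t i : moved (site_of s t i) = (s i != t i).
Proof. by []. Qed.

Lemma mem_changed s t i : (i \in changed s t) = (s i != t i).
Proof. by rewrite mem_filter mem_index_enum andbT. Qed.

(** The elementary matrix of a step of colour [u]. *)
Definition raise u : 'M[F]_3 := if u then delta_mx 2 1 else delta_mx 1 0.

Lemma raiseE u (a b : 'I_3) :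
  raise u a b = ((a == u.+1 :> nat) && (b == u :> nat))%:R.
Proof. by case: u; rewrite mxE -!val_eqE. Qed.

Lemma loc_sites (k : nat) z s t :
  loc q k z (sites s t) =
  amp q k z [seq site_of s t i | i <- changed s t] *
  \prod_(i | s i == t i) (dval q z (x i) (t i) *
      \prod_(j <- changed s t) twist q (site_of s t j) (x i) (t i)).
Proof.
rewrite /loc /sites filter_map big_map; congr (_ * _).
apply: eq_big => [i|i _]; first by rewrite moved_site negbK.
by rewrite big_map /changed big_filter.
Qed.

(** When the sites of [T] change, the factors of the other sites, which are diagonal,
    vanish unless [T] lists all the changes. *)
Lemma prod_bystanders (T : seq 'I_N) (f : 'I_N -> F) s t :
  uniq T -> all (fun i => s i != t i) T ->
  \prod_(k | k \notin T) (f k * (s k == t k)%:R) =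
  (perm_eq T (changed s t))%:R * \prod_(k | s k == t k) f k.
Proof.
move=> uT /allP aT; case: (boolP (perm_eq T _)) => [pT|].
  rewrite mul1r; apply: eq_big => [k|k]; rewrite (perm_mem pT) mem_changed negbK //.
  by move=> ->; rewrite mulr1.
rewrite mul0r; apply: contraNeq => /prodf_neq0 nz.
apply: uniq_perm => // [|k]; first exact: filter_uniq (index_enum_uniq _).
rewrite mem_changed; apply/idP/idP => [/aT //|sk]; apply: contraR sk => /nz.
by case: (s k =P t k) => // _; rewrite mulr0 eqxx.
Qed.

Lemma entry_Gamma0 z s t : entry (Gamma0 q x z) s t = loc q 0%N z (sites s t).
Proof.
have -> : Gamma0 q x z = \prod_(i < N) local i (dg (dval q z (x i))) by [].
rewrite prod_local ?index_enum_uniq // entry_tens loc_sites.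
under eq_bigr => i _ do rewrite mem_index_enum /= dgE.
have -> (f : 'I_N -> F) : \prod_i f i = \prod_(i | i \notin [::]) f i by apply: eq_bigl.
rewrite prod_bystanders //.
have -> : perm_eq [::] (changed s t) = (changed s t == [::]).
  by apply/idP/eqP => [|-> //]; rewrite perm_sym => /perm_small_eq; apply.
case: (changed s t) => [|i T].
  rewrite [amp _ _ _ _](_ : _ = 1) // eqxx !mul1r.
  by apply: eq_bigr => i _; rewrite big_nil mulr1.
rewrite mul0r [amp _ _ _ _](_ : _ = 0) ?mul0r //.
by case: T => [|j [|k T]].
Qed.

Lemma dmatE z i : dmat q x i z = local i (dg (dval q z (x i))).
Proof. by []. Qed.

Lemma dmat1E u z i : dmat1 u q x i z = local i (dg (twist1 q u z (x i))).
Proof. by case: u. Qed.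

Lemma dmat_bwE z i : dmat_bw q x i z = local i (dg (twist_bw q z (x i))).
Proof. by []. Qed.

Lemma emat1E u z i : emat1 u q x i z = amp1 q u z (x i) *: local i (raise u).
Proof. by case: u. Qed.

Lemma emat2E u v z i j : i != j ->
  emat2 u v q x i j z =
  amp2 q u v z (x i) (x j) *: (local i (raise u) * local j (raise v)).
Proof.
move=> ij.
have comm : local j (raise v) * local i (raise u) =
  local i (raise u) * local j (raise v).
  rewrite !local_tens !tens_mul; apply: eq_tens => k.
  case: (eqVneq k j) => [->|_]; last by rewrite mul1mx mulmx1.
  by rewrite eq_sym (negPf ij) mul1mx mulmx1.
have scale2 c a b (A B : operator F N) :
  c *: ((a *: A) * (b *: B)) = (c * (a * b)) *: (A * B).
  by rewrite mulZop mulopZ !scalerA mulrA.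
case: u v comm => [] [] comm; try exact: scale2.
by rewrite -comm; exact: scale2.
Qed.

Lemma entry_term1 z s t u i :
  entry (emat1 u q x i z *
         \prod_(j < N | j != i) (dmat q x j z * dmat1 u q x j (x i))) s t
  = amp1 q u z (x i) * raise u (s i) (t i) * (perm_eq [:: i] (changed s t))%:R *
  \prod_(k | s k == t k) (dval q z (x k) (t k) * twist1 q u (x i) (x k) (t k)).
Proof.
rewrite emat1E.
under [in LHS]eq_bigr do rewrite dmat1E dmatE local_mul dg_mul.
rewrite mulZop entryZ entry_tens1 -!mulrA; congr (_ * _); rewrite raiseE.
case: andP => [[/eqP hs /eqP ht]|_]; last by rewrite !mul0r.
rewrite !mul1r -prod_bystanders ?andbT //=; first by apply: eq_bigl => j; rewrite inE.
by rewrite andbT -val_eqE /= hs ht; case: u {hs ht}.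
Qed.

(** At most one colour is compatible with the states [b] and [a]. *)
Lemma sum_raise (f : bool -> F) (a b : 'I_3) :
  \sum_(u : bool) f u * raise u a b =
  if (b < 2)%N && (a == b.+1 :> nat) then f (b == 1%N :> nat) else 0.
Proof.
rewrite big_bool !raiseE.
by case: a b => [[|[|[|?]]] ?] [[|[|[|?]]] ?] //=;
  rewrite ?(mulr0, mulr1, add0r, addr0).
Qed.

Lemma entry_Gamma1 z s t : entry (Gamma1 q x z) s t = loc q 1%N z (sites s t).
Proof.
rewrite /Gamma1 entry_sum; under eq_bigr do rewrite entry_sum.
under eq_bigr => u _ do under eq_bigr => i _ do rewrite entry_term1.
rewrite exchange_big loc_sites /=.
have [sz|sz] := eqVneq (size (changed s t)) 1%N; last first.
  rewrite big1 => [|i _]; last first.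
    rewrite big1 // => u _; rewrite [perm_eq _ _](_ : _ = false) ?mulr0 ?mul0r //.
    by apply: contraNF sz => /perm_size <-.
  rewrite [amp _ _ _ _](_ : _ = 0) ?mul0r //.
  by case: (changed s t) sz => [|i [|j [|k T]]].
case: (changed s t) sz => [|i []] // _.
rewrite (bigD1 i) //= [X in _ + X]big1 ?addr0 => [|j /negPf ji]; last first.
  rewrite big1 // => u _; rewrite [perm_eq _ _](_ : _ = false) ?mulr0 ?mul0r //.
  by apply/negP => /perm_mem/(_ j); rewrite !inE eqxx ji.
under eq_bigr => u _ do rewrite perm_refl mulr1 mulrAC.
rewrite sum_raise -[single _]/((t i < 2)%N && (s i == (t i).+1 :> nat));
  case: ifP => [/andP[lt2 /eqP si]|_]; last by rewrite mul0r.
congr (_ * _); apply: eq_bigr => k _; rewrite big_seq1 /twist /= si.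
by case: (nat_of_ord (t i)) lt2 => [|[|n]].
Qed.

Lemma entry_term_bw z s t i :
  entry (emat_bw q x i z *
         \prod_(j < N | j != i) (dmat q x j z * dmat_bw q x j (x i))) s t
  = if perm_eq [:: i] (changed s t) && double (site_of s t i) then
    amp_bw q z (x i) *
    \prod_(k | s k == t k) (dval q z (x k) (t k) * twist_bw q (x i) (x k) (t k)) else 0.
Proof.
under [in LHS]eq_bigr do rewrite dmat_bwE dmatE local_mul dg_mul.
rewrite mulZop entryZ entry_tens1 /double /= mxE -!val_eqE /=.
rewrite [X in if _ && X then _ else _]andbC.
case: andP => [[/eqP hs /eqP ht]|_]; last by rewrite mul0r mulr0 andbF.
rewrite mul1r andbT.
have -> (f : 'I_N -> F) : \prod_(j | j != i) f j = \prod_(j | j \notin [:: i]) f j.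
  by apply: eq_bigl => j; rewrite inE.
rewrite prod_bystanders /= ?andbT //; last by rewrite -val_eqE /= hs ht.
by case: ifP => _; rewrite ?mul1r // mul0r mulr0.
Qed.

Lemma entry_term2 z s t u v i j : i != j ->
  entry (emat2 u v q x i j z * \prod_(k < N | (k != i) && (k != j))
     (dmat q x k z * dmat1 u q x k (x i) * dmat1 v q x k (x j))) s t
  = amp2 q u v z (x i) (x j) * raise u (s i) (t i) * raise v (s j) (t j)
   * (perm_eq [:: i; j] (changed s t))%:R *
  \prod_(k | s k == t k)
   (dval q z (x k) (t k) * twist1 q u (x i) (x k) (t k) * twist1 q v (x j) (x k) (t k)).
Proof.
move=> ij; rewrite emat2E //.
under [in LHS]eq_bigr do rewrite !dmat1E dmatE !local_mul !dg_mul.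
rewrite mulZop entryZ entry_tens2 // -!mulrA; congr (_ * _); rewrite !raiseE.
case: andP => [[/eqP hs /eqP ht]|_]; last by rewrite !mul0r.
case: andP => [[/eqP hs' /eqP ht']|_]; last by rewrite !mul0r mulr0.
rewrite !mul1r -prod_bystanders /= ?inE ?ij ?andbT //.
  by apply: eq_bigl => k; rewrite !inE negb_or.
by rewrite -!val_eqE /= hs ht hs' ht'; case: u v {hs ht hs' ht'} => [] [].
Qed.

(** The part of [Gamma2] that changes two sites. *)
Lemma entry_Gamma2_singles z s t (T := changed s t) :
  entry (\sum_(u : bool) \sum_(v : bool)
    \sum_(i < N) \sum_(j < N | (i < j)%N)
      emat2 u v q x i j z *
      \prod_(k < N | (k != i) && (k != j))
        (dmat q x k z * dmat1 u q x k (x i) * dmat1 v q x k (x j))) s t =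
  if size T == 2%N then loc q 2%N z (sites s t) else 0.
Proof.
pose h u v i j := amp2 q u v z (x i) (x j) * raise u (s i) (t i) * raise v (s j) (t j)
   * (perm_eq [:: i; j] T)%:R *
  \prod_(k | s k == t k)
   (dval q z (x k) (t k) * twist1 q u (x i) (x k) (t k) * twist1 q v (x j) (x k) (t k)).
transitivity
  (\sum_(u : bool) \sum_(v : bool) \sum_(i < N) \sum_(j < N | (i < j)%N) h u v i j).
  rewrite entry_sum; apply: eq_bigr => u _; rewrite entry_sum; apply: eq_bigr => v _.
  rewrite entry_sum; apply: eq_bigr => i _; rewrite entry_sum; apply: eq_bigr => j ij.
  by apply: entry_term2; rewrite neq_ltn ij.
have [sz|sz] := eqVneq (size T) 2%N; last first.
  apply: big1 => u _; apply: big1 => v _; apply: big1 => i _; apply: big1 => j _.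
  rewrite /h [perm_eq _ _](_ : _ = false) ?mulr0 ?mul0r //.
  by apply: contraNF sz => /perm_size <-.
have uT : uniq T by apply: filter_uniq (index_enum_uniq _).
(* [T] lists two sites in some order; the sum ranges over ordered pairs. *)
have [a [b [ltab pT]]] : exists a b : 'I_N, (a < b)%N /\ perm_eq [:: a; b] T.
  case: (T) sz uT => [|a [|b []]] // _; rewrite /= inE andbT => ab.
  have : (a != b :> nat) by [].
  rewrite neq_ltn => /orP[lt|lt]; first by exists a, b.
  by exists b, a; split; rewrite // (perm_catC [:: b] [:: a]).
have h0 i j : (i < j)%N -> (i != a) || (j != b) -> perm_eq [:: i; j] T = false.
  move=> ij ne; apply/negP => pij; have : perm_eq [:: i; j] [:: a; b].
    by rewrite (permPl pij) perm_sym.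
  move=> pp; have /(_ i) := perm_mem pp; have /(_ j) := perm_mem pp.
  rewrite !inE !eqxx orbT /= => /esym/orP[]/eqP ej /esym/orP[]/eqP ei; subst i j.
  - by rewrite ltnn in ij.
  - by rewrite ltnNge ltnW in ij.
  - by rewrite !eqxx in ne.
  - by rewrite ltnn in ij.
pose g u v := amp2 q u v z (x a) (x b) * \prod_(k | s k == t k)
   (dval q z (x k) (t k) * twist1 q u (x a) (x k) (t k) * twist1 q v (x b) (x k) (t k)).
have collapse u v : \sum_(i < N) \sum_(j < N | (i < j)%N) h u v i j =
    g u v * raise v (s b) (t b) * raise u (s a) (t a).
  rewrite (bigD1 a) //= (bigD1 b) //= big1 ?addr0 => [|j /andP[aj jb]]; last first.
    by rewrite /h h0 ?jb ?orbT // mulr0 mul0r.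
  rewrite big1 ?addr0 => [|i ia]; last first.
    by apply: big1 => j ij; rewrite /h h0 ?ia // mulr0 mul0r.
  by rewrite /h pT /g mulr1 mulrAC [RHS]mulrAC; congr (_ * _); rewrite mulrAC.
under eq_bigr => u _ do under eq_bigr => v _ do rewrite collapse.
under eq_bigr => u _ do rewrite -mulr_suml sum_raise.
rewrite sum_raise loc_sites -(amp_perm _ _ _ (perm_map _ pT)).
rewrite /amp /= -[single (site_of s t a)]/((t a < 2)%N && (s a == (t a).+1 :> nat)).
rewrite -[single (site_of s t b)]/((t b < 2)%N && (s b == (t b).+1 :> nat)).
case: ifP => [/andP[lta /eqP sa]|_] /=; last by rewrite mul0r.
case: ifP => [/andP[ltb /eqP sb]|_]; last by rewrite mul0r.
rewrite /g; congr (_ * _); apply: eq_bigr => k _.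
rewrite -(perm_big _ pT) /= big_cons big_seq1 -mulrA; congr (_ * _).
rewrite /twist /= sa sb.
by case: (nat_of_ord (t a)) lta => [|[|n]] //; case: (nat_of_ord (t b)) ltb => [|[|m]].
Qed.

Lemma entry_Gamma2 z s t : entry (Gamma2 q x z) s t = loc q 2%N z (sites s t).
Proof.
rewrite /Gamma2 entryD entry_Gamma2_singles entry_sum.
under eq_bigr do rewrite entry_term_bw.
have [sz|sz] := eqVneq (size (changed s t)) 1%N; last first.
  rewrite big1 => [|i _]; last first.
    rewrite [perm_eq _ _](_ : _ = false) ?mulr0 ?mul0r //.
    by apply: contraNF sz => /perm_size <-.
  rewrite add0r; case: ifP => // sz2; rewrite loc_sites.
  rewrite [amp _ _ _ _](_ : _ = 0) ?mul0r //.
  by case: (changed s t) sz sz2 => [|i [|j [|k T]]].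
rewrite sz addr0 loc_sites; case: (changed s t) sz => [|i []] // _.
rewrite (bigD1 i) //= [X in _ + X]big1 ?addr0 => [|j /negPf ji]; last first.
  rewrite [perm_eq _ _](_ : _ = false) //.
  by apply/negP => /perm_mem/(_ j); rewrite !inE eqxx ji.
rewrite perm_refl /=; case: ifP => [|_]; last by rewrite mul0r.
rewrite /double /= => /andP[/eqP ht /eqP hs].
congr (_ * _); apply: eq_bigr => k _; rewrite big_seq1 /twist /=.
by rewrite hs ht.
Qed.

(** Each entry of a column operator is the weight of the list of all the sites. *)
Lemma entry_Gamma (k : 'I_3) z s t : entry (Gamma k q x z) s t = loc q k z (sites s t).
Proof.
case: k => [[|[|[|k]]] //= lt3]; [exact: entry_Gamma0 | exact: entry_Gamma1 |].
exact: entry_Gamma2.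
Qed.

End Entries.

(** * Reduction of a product to the sites that change *)

Section Reduction.
Variables (F : fieldType) (q : F).
Implicit Types (z y : F) (p m : site F) (R : seq (site F)) (k l : nat).

Lemma twist_unmoved p x a : ~~ moved p -> twist q p x a = 1.
Proof.
rewrite negbK /twist => /eqP->.
by case: p.2 => [|[|[|n]]].
Qed.

Lemma prod_twist R x a :
  \prod_(m <- R | moved m) twist q m x a = \prod_(m <- R) twist q m x a.
Proof.
rewrite [RHS](bigID (@moved F)) /= [X in _ * X]big1 ?mulr1 // => m.
exact: twist_unmoved.
Qed.

Lemma loc_cat_unmoved k z R0 R1 : all (fun p => ~~ moved p) R1 ->
  loc q k z (R0 ++ R1) = loc q k z R0 *
   \prod_(p <- R1) (dval q z p.1.1 p.2 * \prod_(m <- R0) twist q m p.1.1 p.2).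
Proof.
move=> /allP aR1; have f1 : [seq p <- R1 | moved p] = [::].
  by apply/eqP; rewrite -(negbK (_ == _)) -has_filter; apply/hasPn.
have t1 y a : \prod_(m <- R1) twist q m y a = 1.
  by rewrite big1_seq // => m /aR1; exact: twist_unmoved.
rewrite /loc filter_cat f1 cats0 big_cat /= -mulrA; congr (_ * (_ * _)).
  by apply: eq_bigr => p _; rewrite !prod_twist big_cat /= t1 mulr1.
rewrite big_seq_cond [RHS]big_seq; apply: eq_big => [p|p _].
  by rewrite andb_idr // => /aR1.
by rewrite prod_twist big_cat /= t1 mulr1.
Qed.

Lemma amp_neq0 k z R : amp q k z R != 0 ->
  all (fun p => p.2 <= p.1.2)%N R /\
  (\sum_(p <- R) p.1.2 = \sum_(p <- R) p.2 + k)%N.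
Proof.
case: R => [|[[x hi] lo] [|[[x' hi'] lo'] [|]]] //=; rewrite ?big_cons ?big_nil /=.
- by case: k => [|k]; rewrite ?eqxx.
- rewrite /single /double /=; case: ifP => [/and3P[/eqP-> _ /eqP-> _]|_].
    by rewrite leqnSn !addn0 addn1.
  by case: ifP => [/and3P[/eqP-> /eqP-> /eqP-> _]|_] //; rewrite eqxx.
- rewrite /single /=.
  case: ifP => [/and3P[/eqP-> /andP[_ /eqP->] /andP[_ /eqP->] _]|_];
    last by rewrite eqxx.
  by rewrite !leqnSn; split => //; rewrite !addn0 !addSn !addnS addn0.
- by rewrite eqxx.
Qed.

(** The operator of index [k] raises states, by [k] in total. *)
Lemma loc_neq0 k z R : loc q k z R != 0 ->
  all (fun p => p.2 <= p.1.2)%N R /\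
  (\sum_(p <- R) p.1.2 = \sum_(p <- R) p.2 + k)%N.
Proof.
rewrite mulf_eq0 negb_or => /andP[/amp_neq0[/allP le1 sum1] _]; split.
  apply/allP => p pR; have [mp|] := boolP (moved p); first by apply: le1;
    rewrite mem_filter mp.
  by rewrite negbK => /eqP->.
rewrite (bigID (@moved F)) /= [X in (_ = X + _)%N](bigID (@moved F)) /=.
move: sum1; rewrite !big_filter => ->; rewrite addnAC; congr (_ + _)%N; congr (_ + _)%N.
by apply: eq_bigr => p; rewrite negbK => /eqP.
Qed.

(** Twisting factors are multiplicative along successive changes of a site. *)
Lemma twistM x hi mid lo w a :
  (lo <= mid <= hi)%N -> (hi < 3)%N -> (a < 3)%N -> generic_q q -> apart q x w ->
  twist q (w, hi, mid) x a * twist q (w, mid, lo) x a = twist q (w, hi, lo) x a.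
Proof.
move=> /andP[] + + + + [? ? ?] [? ? ?].
have ? : q * x - w != 0 by rewrite -oppr_eq0 opprB.
case: hi mid lo a => [|[|[|//]]] [|[|[|//]]] [|[|[|//]]] [|[|[|//]]] //= _ _ _ _;
  rewrite /twist /= ?mulr1 ?mul1r // /twist_w /twist_b /twist_bw /= ?mulr1 //; field;
    nz.
Qed.

(** The lists of intermediate states of the sites of [R], each between the initial and
    the final state of the site. *)
Fixpoint choices R : seq (seq nat) :=
  if R is p :: R' then
    [seq a :: r | a <- iota p.2 (p.1.2 - p.2).+1, r <- choices R']
  else [:: [::]].

Lemma choices_cons p R : choices (p :: R) =
  [seq a :: r | a <- iota p.2 (p.1.2 - p.2).+1, r <- choices R].
Proof. by []. Qed.

(** The sites of [R] as seen by the operator acting last, resp. first, when [r] lists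
    their intermediate states. *)
Definition uppers R (r : seq nat) : seq (site F) :=
  [seq (pm.1.1.1, pm.1.1.2, pm.2) | pm <- zip R r].
Definition lowers R (r : seq nat) : seq (site F) :=
  [seq (pm.1.1.1, pm.2, pm.1.2) | pm <- zip R r].

(** The sum over intermediate states for the sites of [R] alone, the operator of
    parameter [y] and index [l] acting first. *)
Definition pairsum k l z y R : F :=
  \sum_(r <- choices R) loc q k z (uppers R r) * loc q l y (lowers R r).

Lemma uniq_choices R : uniq (choices R).
Proof.
elim: R => // p R IH; rewrite choices_cons; apply: (@allpairs_uniq _ _ _ cons) => //;
  first exact: iota_uniq.
by move=> [m r] [m' r'] _ _ /= [-> ->].
Qed.

Section Configs.
Variables (N : nat) (x : 'I_N -> F).
Implicit Types (s t r : config N).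

(** The configurations between [t] and [s]. *)
Definition box s t : pred (config N) := fun r => [forall i, (t i <= r i <= s i)%N].

Lemma mem_choices s t (L : seq 'I_N) (w : seq nat) :
  (forall i, (t i <= s i)%N) ->
  (w \in choices [seq site_of x s t i | i <- L]) =
  (size w == size L) && all (fun iw => (t iw.1 <= iw.2 <= s iw.1)%N) (zip L w).
Proof.
move=> ts; elim: L w => [|i L IH] [|m w] //; rewrite map_cons choices_cons.
  by apply/negP => /allpairsP[[a b] [_ _ /=]].
rewrite [RHS]/= eqSS [RHS]andbCA -IH; apply/allpairsP/idP => [[[a b] [ma mb [-> ->]]]|].
  by move: ma mb; rewrite mem_iota addnS ltnS subnKC //= => -> ->.
case/andP=> mi mw; exists (m, w); split => //.
by rewrite mem_iota /= addnS ltnS subnKC.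
Qed.

(** A configuration between [t] and [s] is determined by its states at the sites
    that change. *)
Lemma sum_box s t (L : seq 'I_N) (H : seq nat -> F) :
  (forall i, (t i <= s i)%N) -> perm_eq L (changed s t) ->
  \sum_(r | box s t r) H [seq r i : nat | i <- L] =
  \sum_(w <- choices [seq site_of x s t i | i <- L]) H w.
Proof.
move=> ts pL; have uL : uniq L by rewrite (perm_uniq pL) filter_uniq ?index_enum_uniq.
have offL i : i \notin L -> s i = t i.
  by rewrite (perm_mem pL) mem_changed negbK => /eqP.
rewrite -big_enum -(big_map (fun r : config N => [seq r i : nat | i <- L]) xpredT).
apply: perm_big; apply: uniq_perm.
- rewrite map_inj_in_uniq ?enum_uniq // => r r'.
  rewrite !mem_enum => /forallP br /forallP br' /eq_in_map e; apply: configP => i.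
  apply: val_inj; have [iL|iL] := boolP (i \in L); first exact: e.
  move: (br i) (br' i); rewrite (offL _ iL) => /anti_leq e1 /anti_leq e2.
  by rewrite /= -e1 e2.
- exact: uniq_choices.
move=> w; rewrite mem_choices //; apply/mapP/andP => [[r]|[/eqP sz /allP bw]].
  rewrite mem_enum => /forallP br ->; rewrite size_map; split => //.
  have -> : zip L [seq r i : nat | i <- L] = [seq (i, r i : nat) | i <- L].
    by elim: (L) => //= i L' ->.
  by apply/allP => _ /mapP[i _ ->]; exact: br.
(* Conversely, a list of states is spread over the sites of [L]. *)
pose r : config N := [ffun i => if i \in L then inord (nth 0%N w (index i L)) else t i].
have rL i : i \in L ->
    r i = nth 0%N w (index i L) :> nat /\ (t i <= nth 0%N w (index i L) <= s i)%N.
  move=> iL; have lt : (index i L < size L)%N by rewrite index_mem.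
  have bi : (t i <= nth 0%N w (index i L) <= s i)%N.
    have := bw (i, nth 0%N w (index i L)); apply.
    rewrite -{1}(nth_index i iL) -nth_zip //; apply: mem_nth.
    by rewrite size_zip sz minnn.
  split => //; rewrite ffunE iL inordK //.
  by case/andP: bi => _ le; apply: leq_ltn_trans le (ltn_ord _).
exists r; last first.
  apply: (@eq_from_nth _ 0%N); first by rewrite size_map.
  move=> j; rewrite sz => jL.
  have [i0 _] : exists i0, i0 \in L.
    by case: (L) jL => // i0 L' _; exists i0; rewrite mem_head.
  rewrite (nth_map i0) // (rL _ (mem_nth _ _)).1 ?index_uniq //.
rewrite mem_enum; apply/forallP => i; have [iL|iL] := boolP (i \in L).
  by rewrite !(rL _ iL).1 (rL _ iL).2.
by rewrite ffunE (negPf iL) leqnn ts.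
Qed.

Hypotheses (gq : generic_q q) (gx : forall i j, i != j -> apart q (x i) (x j)).

(** The common factor of the sites where [s] and [t] agree. *)
Definition bystanders z y s t (L : seq 'I_N) : F :=
  \prod_(i <- index_enum 'I_N | s i == t i)
     (dval q z (x i) (t i) * dval q y (x i) (t i) *
       \prod_(j <- L) twist q (site_of x s t j) (x i) (t i)).

Lemma bystandersC z y s t L : bystanders z y s t L = bystanders y z s t L.
Proof. by apply: eq_bigr => i _; rewrite [dval q z _ _ * _]mulrC. Qed.

(** Here [b] selects sites that do not change, and [w] gives their states. *)
Lemma loc_sites_split k z (s t w : config N) (b : pred 'I_N) (L : seq 'I_N) :
  perm_eq L [seq i <- index_enum 'I_N | ~~ b i] ->
  (forall i, b i -> s i = w i /\ t i = w i) ->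
  loc q k z (sites x s t) = loc q k z [seq site_of x s t i | i <- L] *
   \prod_(i <- index_enum 'I_N | b i)
     (dval q z (x i) (w i) * \prod_(j <- L) twist q (site_of x s t j) (x i) (w i)).
Proof.
move=> pL eqb; set D := [seq i <- index_enum 'I_N | b i].
have pLD : perm_eq (index_enum 'I_N) (L ++ D).
  rewrite perm_sym perm_catC; apply: perm_trans (permEl (perm_filterC b _)).
  by rewrite perm_cat2l.
rewrite (loc_perm _ _ _ (perm_map (site_of x s t) pLD)) map_cat loc_cat_unmoved;
  last first.
  apply/allP => _ /mapP[i + ->]; rewrite mem_filter => /andP[/eqb[si ti] _].
  by rewrite moved_site si ti eqxx.
rewrite big_map big_filter; congr (_ * _); apply: eq_bigr => i /eqb[_ ti].
by rewrite big_map /= ti.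
Qed.

Lemma entry_product (k l : 'I_3) z y s t (L : seq 'I_N) :
  perm_eq L (changed s t) ->
  entry (Gamma k q x z * Gamma l q x y) s t =
  if [forall i, (t i <= s i)%N]
  then bystanders z y s t L * pairsum k l z y [seq site_of x s t i | i <- L] else 0.
Proof.
move=> pL; rewrite entryM.
under eq_bigr do rewrite !entry_Gamma.
(* Only the intermediate configurations between [t] and [s] contribute. *)
rewrite (bigID (box s t)) /= [X in _ + X]big1 ?addr0 => [|r]; last first.
  apply: contraNeq; rewrite mulf_eq0 negb_or =>
    /andP[/loc_neq0[/allP sr _] /loc_neq0[/allP rt _]].
  apply/forallP => i; apply/andP; split.
    by apply: (rt (site_of x r t i)); rewrite map_f ?mem_index_enum.
  by apply: (sr (site_of x s r i)); rewrite map_f ?mem_index_enum.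
case: ifP => [/forallP ts|/negP ts]; last first.
  rewrite big1 // => r /forallP br; case: ts; apply/forallP => i.
  by case/andP: (br i) => ? ?; apply: leq_trans (_ : r i <= _)%N.
rewrite /pairsum -sum_box // mulr_sumr; apply: eq_bigr => r /forallP br.
have eqr i : s i == t i -> r i = t i.
  by move/eqP => st; apply: val_inj; move: (br i); rewrite st => /anti_leq.
rewrite (@loc_sites_split _ _ _ _ t (fun i => s i == t i) L) //; last first.
  by move=> i st; rewrite eqr // (eqP st).
rewrite (@loc_sites_split _ _ r t t (fun i => s i == t i) L) //; last first.
  by move=> i st; rewrite eqr.
rewrite mulrACA mulrC; congr (_ * _).
  rewrite -big_split /=; apply: eq_bigr => i st.
  rewrite mulrACA -big_split /=; congr (_ * _).
  rewrite big_seq [RHS]big_seq; apply: eq_bigr => j.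
  rewrite (perm_mem pL) mem_changed => sj; apply: twistM => //.
  by apply: gx; apply: contraNneq sj => <-.
have zipE : zip [seq site_of x s t i | i <- L] [seq r i : nat | i <- L] =
    [seq (site_of x s t i, r i : nat) | i <- L] by elim: (L) => //= i L' ->.
by rewrite /uppers /lowers zipE -!map_comp.
Qed.
End Configs.
End Reduction.

(** * Evaluation of the sums over intermediate states *)

Section Evaluation.
Variables (F : fieldType) (q : F).
Implicit Types (x y z w : F) (u v : bool) (k l a : nat) (p : site F).

(** A single step of colour [u], and a jump 0 -> 2. *)
Definition step x u : site F := (x, u.+1, nat_of_bool u).
Definition jump x : site F := (x, 2, 0)%N.

Lemma moved_up x u : moved (x, u.+1, nat_of_bool u) = true.
Proof. by case: u. Qed.

Lemma moved_id x a : moved (x, a, a) = false.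
Proof. by rewrite /moved eqxx. Qed.

Lemma twist_up w u x a : twist q (w, u.+1, nat_of_bool u) x a = twist1 q u w x a.
Proof. by case: u. Qed.

Lemma amp0E k z : amp q k z [::] = (k == 0%N)%:R. Proof. by []. Qed.

Lemma amp_up k z x u : amp q k z [:: (x, u.+1, nat_of_bool u)] =
  if (k == 1)%N then amp1 q u z x else 0.
Proof. by case: u; rewrite /amp /single /double /= ?andbF //= andbT. Qed.

Lemma amp_up2 k z x u y v :
  amp q k z [:: (x, u.+1, nat_of_bool u); (y, v.+1, nat_of_bool v)] =
  if (k == 2)%N then amp2 q u v z x y else 0.
Proof. by case: u; case: v; rewrite /amp /single /= andbT. Qed.

Lemma choices_up x u R : choices ((x, u.+1, nat_of_bool u) :: R) =
   [seq nat_of_bool u :: r | r <- choices R] ++ [seq u.+1 :: r | r <- choices R].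
Proof. by rewrite choices_cons subSnn /= cats0. Qed.

Lemma amp3E k z p p' p'' R : amp q k z [:: p, p', p'' & R] = 0.
Proof. by []. Qed.

(** Filtering the list before taking products makes [loc] quick to unroll. *)
Lemma locE k z R : loc q k z R =
  amp q k z [seq p <- R | moved p] *
  \prod_(p <- [seq p <- R | ~~ moved p])
    (dval q z p.1.1 p.2 * \prod_(m <- [seq p <- R | moved p]) twist q m p.1.1 p.2).
Proof.
by rewrite /loc big_filter; congr (_ * _); apply: eq_bigr => p _; rewrite big_filter.
Qed.

Definition zeroE := (mul0r, mulr0, mul1r, mulr1, add0r, addr0).
Arguments amp : simpl never.
Arguments amp2 : simpl never.

(** Unrolls [pairsum] on an explicit list of steps, dropping the terms whose
    amplitude vanishes before unrolling their products. *)
Ltac expand_pairsum :=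
  rewrite /pairsum !choices_up /= !(big_cons, big_nil) /uppers /lowers /= !locE /=;
  rewrite !moved_up !moved_id /= !(amp0E, amp_up, amp_up2, amp3E) /= !zeroE;
  rewrite ?(big_cons, big_nil) /= ?twist_up ?zeroE.

Hypothesis gq : generic_q q.

(** The factor relating the weight of a step to that of its point, over both
    operators. *)
Definition norm1 u z y x := color_norm q u * site_norm q u z x * site_norm q u y x.

Lemma norm1C u z y x : norm1 u z y x = norm1 u y z x.
Proof. by rewrite /norm1 mulrAC. Qed.

Variables (z y : F).

Lemma pairsum_steps10 x u : regular q z x -> regular q y x ->
  pairsum q 1%N 0%N z y [:: step x u] = norm1 u z y x * pts10 q z y (point q u x).
Proof.
move=> rz ry.
expand_pairsum.
rewrite !(amp1E, dval_initial, dval_final) // /pts10 /norm1; ring.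
Qed.

Lemma pairsum_steps01 x u : regular q z x -> regular q y x ->
  pairsum q 0%N 1%N z y [:: step x u] = norm1 u z y x * pts01 z y (point q u x).
Proof.
move=> rz ry.
expand_pairsum.
rewrite !(amp1E, dval_initial, dval_final) // /pts01 /norm1; ring.
Qed.

Lemma amp2_pointE u v z' x x' : z' != 0 -> apart q x x' -> regular q z' x ->
  regular q z' x' ->
  amp2 q u v z' x x' = pair_norm q u v x x' * pair_amp q z' (point q u x) (point q v x')
   * (color_norm q u * site_norm q u z' x) * (color_norm q v * site_norm q v z' x').
Proof.
move=> z0 ap r r'; rewrite amp2E // !amp1E // /pair_amp /pair_scal.
case: gq => ? ? ?; field; nz.
Qed.
Hypotheses (z0 : z != 0) (y0 : y != 0).

Definition norm2 u v x x' := pair_norm q u v x x' * (norm1 u z y x * norm1 v z y x').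

(** Both spectral parameters are regular at [x]. *)
Definition fits x := regular q z x /\ regular q y x.

Lemma apartC x x' : apart q x x' -> apart q x' x.
Proof. by case => h ? ?; split => //; rewrite -oppr_eq0 opprB. Qed.

(** [crossE] for the opposite order of the steps, with the same factor [pair_norm]. *)
Lemma crossC u v x x' : apart q x x' ->
  twist1 q v x' x u * twist1 q u x x' v.+1 =
  pair_norm q u v x x' * phi q (point q v x') (point q u x).
Proof. by move=> /apartC h; rewrite crossE // pair_normC. Qed.

(** In each case below, the sum over intermediate states is the sum for the points,
    times a factor which is symmetric in [z] and [y] and does not depend on the indices
    of the operators. *)
Section Two.
Variables (x1 x2 : F) (u1 u2 : bool).
Hypotheses (f1 : fits x1) (f2 : fits x2) (a12 : apart q x1 x2).

Lemma pairsum_steps11 :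
  pairsum q 1%N 1%N z y [:: step x1 u1; step x2 u2] =
  norm2 u1 u2 x1 x2 * pts11 q z y (point q u1 x1) (point q u2 x2).
Proof.
case: f1 f2 => ? ? [? ?]; expand_pairsum.
rewrite !(amp1E, dval_initial, dval_final, amp2_pointE) // /pts11 /norm2 /norm1.
ring: (crossE gq u1 u2 a12) (crossC u1 u2 a12).
Qed.

Lemma pairsum_steps20 :
  pairsum q 2%N 0%N z y [:: step x1 u1; step x2 u2] =
  norm2 u1 u2 x1 x2 * pts20 q z y (point q u1 x1) (point q u2 x2).
Proof.
case: f1 f2 => ? ? [? ?]; expand_pairsum.
rewrite !(amp1E, dval_initial, dval_final, amp2_pointE) // /pts20 /norm2 /norm1.
ring: (crossE gq u1 u2 a12) (crossC u1 u2 a12).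
Qed.

Lemma pairsum_steps02 :
  pairsum q 0%N 2%N z y [:: step x1 u1; step x2 u2] =
  norm2 u1 u2 x1 x2 * pts02 q z y (point q u1 x1) (point q u2 x2).
Proof.
case: f1 f2 => ? ? [? ?]; expand_pairsum.
rewrite !(amp1E, dval_initial, dval_final, amp2_pointE) // /pts02 /norm2 /norm1.
ring: (crossE gq u1 u2 a12) (crossC u1 u2 a12).
Qed.
End Two.

Section Three.
Variables (x1 x2 x3 : F) (u1 u2 u3 : bool).
Hypotheses (f1 : fits x1) (f2 : fits x2) (f3 : fits x3)
  (a12 : apart q x1 x2) (a13 : apart q x1 x3) (a23 : apart q x2 x3).

Lemma pairsum_steps21 :
  pairsum q 2%N 1%N z y [:: step x1 u1; step x2 u2; step x3 u3] =
  pair_norm q u1 u2 x1 x2 * pair_norm q u1 u3 x1 x3 * pair_norm q u2 u3 x2 x3 *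
  (norm1 u1 z y x1 * norm1 u2 z y x2 * norm1 u3 z y x3)
  * pts21 q z y (point q u1 x1) (point q u2 x2) (point q u3 x3).
Proof.
case: f1 f2 f3 => ? ? [? ?] [? ?].
expand_pairsum.
rewrite !(amp1E, dval_initial, dval_final, amp2_pointE) // /pts21 /pts21_term /norm1.
ring: (crossE gq u1 u2 a12) (crossE gq u1 u3 a13) (crossE gq u2 u3 a23)
 (crossC u1 u2 a12) (crossC u1 u3 a13) (crossC u2 u3 a23).
Qed.

Lemma pairsum_steps12 :
  pairsum q 1%N 2%N z y [:: step x1 u1; step x2 u2; step x3 u3] =
  pair_norm q u1 u2 x1 x2 * pair_norm q u1 u3 x1 x3 * pair_norm q u2 u3 x2 x3 *
  (norm1 u1 z y x1 * norm1 u2 z y x2 * norm1 u3 z y x3)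
  * pts12 q z y (point q u1 x1) (point q u2 x2) (point q u3 x3).
Proof.
case: f1 f2 f3 => ? ? [? ?] [? ?].
expand_pairsum.
rewrite !(amp1E, dval_initial, dval_final, amp2_pointE) // /pts12 /pts12_term /norm1.
ring: (crossE gq u1 u2 a12) (crossE gq u1 u3 a13) (crossE gq u2 u3 a23)
 (crossC u1 u2 a12) (crossC u1 u3 a13) (crossC u2 u3 a23).
Qed.
End Three.
Section Four.
Variables (x1 x2 x3 x4 : F) (u1 u2 u3 u4 : bool).
Hypotheses (f1 : fits x1) (f2 : fits x2) (f3 : fits x3) (f4 : fits x4)
  (a12 : apart q x1 x2) (a13 : apart q x1 x3) (a23 : apart q x2 x3)
  (a14 : apart q x1 x4) (a24 : apart q x2 x4) (a34 : apart q x3 x4).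

Lemma pairsum_steps22 :
  pairsum q 2%N 2%N z y [:: step x1 u1; step x2 u2; step x3 u3; step x4 u4] =
  pair_norm q u1 u2 x1 x2 * pair_norm q u1 u3 x1 x3 * pair_norm q u2 u3 x2 x3 *
  pair_norm q u1 u4 x1 x4 * pair_norm q u2 u4 x2 x4 * pair_norm q u3 u4 x3 x4 *
  (norm1 u1 z y x1 * norm1 u2 z y x2 * norm1 u3 z y x3 * norm1 u4 z y x4)
  * pts22 q z y (point q u1 x1) (point q u2 x2) (point q u3 x3) (point q u4 x4).
Proof.
case: f1 f2 f3 f4 => ? ? [? ?] [? ?] [? ?].
expand_pairsum.
rewrite !(amp1E, dval_initial, dval_final, amp2_pointE) // /pts22 /pts22_term /norm1.
ring: (crossE gq u1 u2 a12) (crossE gq u1 u3 a13) (crossE gq u2 u3 a23)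
 (crossC u1 u2 a12) (crossC u1 u3 a13) (crossC u2 u3 a23)
 (crossE gq u1 u4 a14) (crossE gq u2 u4 a24) (crossE gq u3 u4 a34)
 (crossC u1 u4 a14) (crossC u2 u4 a24) (crossC u3 u4 a34).
Qed.
End Four.

Lemma choices_jump x R : choices (jump x :: R) =
   [seq 0%N :: r | r <- choices R] ++ [seq 1%N :: r | r <- choices R]
   ++ [seq 2%N :: r | r <- choices R].
Proof. by rewrite choices_cons /= cats0. Qed.

Lemma amp_jump k x z' : amp q k z' [:: (x, 2, 0)%N] =
  if (k == 2)%N then amp_bw q z' x else 0.
Proof. by rewrite /amp /single /double /= andbF andbT. Qed.

Lemma amp_jump_l k x z' p : amp q k z' [:: (x, 2, 0)%N; p] = 0.
Proof. by rewrite /amp /single /= andbF. Qed.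

Lemma amp_jump_r k x z' p : amp q k z' [:: p; (x, 2, 0)%N] = 0.
Proof. by rewrite /amp /single /= !andbF. Qed.

Lemma amp_white x k z' : amp q k z' [:: (x, 1, 0)%N] =
  if (k == 1)%N then amp_w q z' x else 0.
Proof. exact: (amp_up k z' x false). Qed.

Lemma amp_black x k z' : amp q k z' [:: (x, 2, 1)%N] =
  if (k == 1)%N then amp_b q z' x else 0.
Proof. exact: (amp_up k z' x true). Qed.

Lemma amp_white_up x k z' w v : amp q k z' [:: (x, 1, 0)%N; (w, v.+1, nat_of_bool v)] =
  if (k == 2)%N then amp2 q false v z' x w else 0.
Proof. exact: (amp_up2 k z' x false). Qed.

Lemma amp_black_up x k z' w v : amp q k z' [:: (x, 2, 1)%N; (w, v.+1, nat_of_bool v)] =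
  if (k == 2)%N then amp2 q true v z' x w else 0.
Proof. exact: (amp_up2 k z' x true). Qed.

Lemma amp_white_white x k z' w : amp q k z' [:: (x, 1, 0)%N; (w, 1, 0)%N] =
  if (k == 2)%N then amp_w_w q z' x w else 0.
Proof. exact: (amp_up2 k z' x false _ false). Qed.

Lemma amp_black_black x k z' w : amp q k z' [:: (x, 2, 1)%N; (w, 2, 1)%N] =
  if (k == 2)%N then amp_b_b q z' x w else 0.
Proof. exact: (amp_up2 k z' x true _ true). Qed.

Lemma twist_jump x w a : twist q (x, 2, 0)%N w a = twist_bw q x w a.
Proof. by []. Qed.

Lemma twist_white x w a : twist q (x, 1, 0)%N w a = twist_w q x w a.
Proof. by []. Qed.

Lemma twist_black x w a : twist q (x, 2, 1)%N w a = twist_b q x w a.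
Proof. by []. Qed.

Lemma dval0 z' x : dval q z' x 0%N = 1. Proof. by []. Qed.

Lemma twist0 u w x : twist1 q u w x 0%N = 1. Proof. by case: u. Qed.

Lemma twist_bw0 w x : twist_bw q w x 0%N = 1. Proof. by []. Qed.

Definition jumpE := (amp_jump, amp_jump_l, amp_jump_r, amp_white, amp_black,
  amp_white_up, amp_black_up, amp_white_white, amp_black_black).

(** The analogue of [expand_pairsum] for lists that contain jumps. *)
Ltac expand_jumps :=
  rewrite /pairsum !(choices_jump, choices_up) /= !(big_cons, big_nil) /uppers /lowers
    /= !locE /=;
  rewrite ?(moved_up, moved_id) /= !(amp3E, amp0E, amp_up, amp_up2, jumpE) /= !zeroE;
  rewrite ?(big_cons, big_nil) /= ?(twist_up, twist_jump, twist_white, twist_black,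
    dval0, twist0, twist_bw0) ?zeroE.

Lemma pairsum_jump11 x : pairsum q 1%N 1%N z y [:: jump x] = jmp11 q z y x.
Proof. expand_jumps; rewrite /jmp11; ring. Qed.

Lemma pairsum_jump20 x : pairsum q 2%N 0%N z y [:: jump x] = jmp20 q z y x.
Proof. expand_jumps; rewrite /jmp20; ring. Qed.

Lemma pairsum_jump02 x : pairsum q 0%N 2%N z y [:: jump x] = jmp02 q z y x.
Proof. expand_jumps; rewrite /jmp02; ring. Qed.

Lemma pairsum_jumps22 x1 x2 :
  pairsum q 2%N 2%N z y [:: jump x1; jump x2] = jmps22 q z y x1 x2.
Proof. expand_jumps; rewrite /jmps22; ring. Qed.

(** The factor by which the interaction of a jump at [x] with a step of colour [u] at
    [w] differs from its interaction with the point of that step. *)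
Definition rho u x w : F := if u then (w - q ^+ 2 * x) / (w - x) else 1.

Lemma jump_stepE u x w : apart q x w ->
  [/\ pair_norm q false u x w * twist_b q x w u.+1 =
        rho u x w * split_step_first q x (point q u w),
      twist_w q x w u * pair_norm q true u x w =
        rho u x w * split_step_second x (point q u w),
      twist_bw q x w u.+1 = rho u x w * step_then_jump q x (point q u w) &
      twist_bw q x w u * twist1 q u w x 2%N =
        rho u x w * jump_then_step q x (point q u w)].
Proof.
case: gq => ? ? ? [? ? ?]; rewrite /twist_b /twist_w /twist_bw /split_step_first
  /split_step_second /step_then_jump /jump_then_step.
by case: u; rewrite /= /twist_b /twist_w /=; split; field; nz.
Qed.

Lemma amp2_blackE v z' x w : z' != 0 -> apart q x w -> regular q z' x ->
  regular q z' w ->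
  amp2 q true v z' x w = pair_norm q true v x w * pair_scal q z' (x / q) (point q v w)
   * amp_b q z' x * (color_norm q v * site_norm q v z' w).
Proof.
move=> z0' ap r r'; rewrite amp2E // (amp1E gq v) // /pair_scal /=.
case: gq => ? ? ?; field; nz.
Qed.

Lemma amp2_whiteE v z' x w : z' != 0 -> apart q x w -> regular q z' x ->
  regular q z' w ->
  amp2 q false v z' x w = pair_norm q false v x w * pair_scal q z' x (point q v w)
   * amp_w q z' x * (color_norm q v * site_norm q v z' w).
Proof.
move=> z0' ap r r'; rewrite amp2E // (amp1E gq v) // /pair_scal /=.
case: gq => ? ? ?; field; nz.
Qed.

Lemma pairsum_mix21 x x1 u1 : apart q x x1 -> fits x -> fits x1 ->
  pairsum q 2%N 1%N z y [:: jump x; step x1 u1] =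
   rho u1 x x1 * norm1 u1 z y x1 * mix21 q z y x (point q u1 x1).
Proof.
move=> a01 [? ?] [? ?]; have [e1 e2 e3 e4] := jump_stepE u1 a01.
expand_jumps.
rewrite !(amp2_blackE, amp2_whiteE, amp1E, dval_initial, dval_final) // /norm1 /mix21
  /jmp11.
ring: e1 e2 e3 e4.
Qed.

Lemma pairsum_mix12 x x1 u1 : apart q x x1 -> fits x -> fits x1 ->
  pairsum q 1%N 2%N z y [:: jump x; step x1 u1] =
   rho u1 x x1 * norm1 u1 z y x1 * mix12 q z y x (point q u1 x1).
Proof.
move=> a01 [? ?] [? ?]; have [e1 e2 e3 e4] := jump_stepE u1 a01.
expand_jumps.
rewrite !(amp2_blackE, amp2_whiteE, amp1E, dval_initial, dval_final) // /norm1 /mix12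
  /jmp11 /jmp02.
ring: e1 e2 e3 e4.
Qed.

Lemma pairsum_mix22 x x1 u1 x2 u2 : apart q x x1 -> apart q x x2 -> apart q x1 x2 ->
   fits x -> fits x1 -> fits x2 ->
  pairsum q 2%N 2%N z y [:: jump x; step x1 u1; step x2 u2] =
   pair_norm q u1 u2 x1 x2 * (rho u1 x x1 * norm1 u1 z y x1) *
     (rho u2 x x2 * norm1 u2 z y x2) *
  mix22 q z y x (point q u1 x1) (point q u2 x2).
Proof.
move=> a01 a02 a12 [? ?] [? ?] [? ?]; have [e1 e2 e3 e4] := jump_stepE u1 a01.
have [e5 e6 e7 e8] := jump_stepE u2 a02.
expand_jumps.
rewrite !(amp2_blackE, amp2_whiteE, amp2_pointE, amp1E, dval_initial, dval_final) //
  /norm1 /mix22 /mix22_term /jmp11 /jmp02.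
ring: e1 e2 e3 e4 e5 e6 e7 e8 (crossE gq u1 u2 a12) (crossC u1 u2 a12).
Qed.
End Evaluation.

(** * The exchange relations on the changed sites *)

Section Exchange.
Variables (F : fieldType) (q : F).
Implicit Types (x y z : F) (k l : nat) (R : seq (site F)).

(** The right-hand side of the exchange relation of indices [k], [l], for entries
    [f i j]: the weights vanish unless [i + j = k + l]. *)
Definition weighted_sum z y k l (f : nat -> nat -> F) : F :=
  let t i j := weight q y z i j k l * f i j in
  match (k + l)%N with
  | 0 => t 0%N 0%N
  | 1 => t 0%N 1%N + t 1%N 0%N
  | 2 => t 0%N 2%N + t 1%N 1%N + t 2%N 0%N
  | 3 => t 1%N 2%N + t 2%N 1%N
  | _ => t 2%N 2%N
  end.

Lemma weighted_sumE z y (k l : 'I_3) (f : nat -> nat -> F) :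
  \sum_(i < 3) \sum_(j < 3) IKweight q y z i j k l * f i j = weighted_sum z y k l f.
Proof.
rewrite !big_ord_recl !big_ord0 /=.
case: k l => [[|[|[|//]]] ?] [[|[|[|//]]] ?];
  rewrite /weighted_sum /= /weight /IKweight !inordK //=;
  by rewrite /bump /= ?(mul0r, addr0, add0r, addrA).
Qed.

Lemma weighted_sum0 z y k l f :
  (forall i j, (i + j = k + l)%N -> f i j = 0) -> (k + l <= 4)%N ->
  weighted_sum z y k l f = 0.
Proof.
rewrite /weighted_sum; case: (k + l)%N => [|[|[|[|[|//]]]]] f0 _;
  by rewrite !f0 // !mulr0 ?addr0.
Qed.

Lemma size_choices R (r : seq nat) : r \in choices R -> size r = size R.
Proof.
elim: R r => [|p R IH] r; first by rewrite inE => /eqP->.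
by rewrite choices_cons => /allpairsP[[a b] [_ /IH sz ->]] /=; rewrite sz.
Qed.

(** Conservation of the total degree. *)
Lemma pairsum_neq0 k l z y R : pairsum q k l z y R != 0 ->
  (\sum_(p <- R) p.1.2 = \sum_(p <- R) p.2 + (k + l))%N.
Proof.
move=> ps.
have : has (fun r => loc q k z (uppers R r) * loc q l y (lowers R r) != 0) (choices R).
  apply: contraNT ps => /hasPn ps; rewrite /pairsum big_seq big1 // => r /ps.
  by rewrite negbK => /eqP.
case/hasP=> r /size_choices sz; rewrite mulf_eq0 negb_or.
case/andP=> /loc_neq0[_ +] /loc_neq0[_ +]; rewrite !big_map /= => E1 E2.
have e (f : site F -> nat) : (\sum_(p <- R) f p = \sum_(p <- zip R r) f p.1)%N.
  by rewrite -(big_map fst xpredT) -/(unzip1 _) unzip1_zip ?sz.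
by rewrite (e (fun p => p.1.2)) (e (fun p => p.2)) E1 E2 -addnA [(l + k)%N]addnC.
Qed.
End Exchange.

Section Relation.
Variables (F : fieldType) (q : F) (N : nat) (x : 'I_N -> F) (u : 'I_N -> bool).
Variables (z y : F).
Hypotheses (gq : generic_q q) (z0 : z != 0) (y0 : y != 0) (rW : regular q z y).
Hypotheses (gx : forall i j, i != j -> apart q (x i) (x j)).
Hypotheses (fx : forall i, fits q z y (x i)).

Lemma jump_point v a b : apart q a b ->
 [/\ a - point q v b != 0, q * point q v b - a != 0 & a - q * point q v b != 0].
Proof.
move=> ab; split; first exact: (point_apart gq false v ab).
  case: gq ab => ? ? ? [? ? ?]; case: v => /=; last by nz.
  by rewrite mulrCA mulfV // mulr1 -oppr_eq0 opprB.
case: gq ab => ? ? ? [? ? ?]; case: v => /=; last by nz.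
by rewrite mulrCA mulfV // mulr1.
Qed.

(** The exchange relations restricted to the sites that change, those of [Ld] by a jump
    and those of [Ls] by a step. *)
Lemma pairsum_exchange (Ld Ls : seq 'I_N) k l : uniq (Ld ++ Ls) ->
  (k < 3)%N -> (l < 3)%N ->
  let R := [seq jump (x i) | i <- Ld] ++ [seq step (x i) (u i) | i <- Ls] in
  pairsum q k l z y R = weighted_sum q z y k l (fun i j => pairsum q j i y z R).
Proof.
move=> uL k3 l3 R.
have hi : (\sum_(p <- R) p.1.2 = \sum_(p <- R) p.2 + ((size Ld).*2 + size Ls))%N.
  rewrite !big_cat !big_map /= addnACA; congr (_ + _)%N.
    by rewrite -mul2n -sum1_size big_distrr -big_split.
  by rewrite -sum1_size -big_split /=; apply: eq_bigr => i _; rewrite addn1.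
(* If the total degrees differ, both sides vanish. *)
have [c|c] := eqVneq ((size Ld).*2 + size Ls)%N (k + l)%N; last first.
  rewrite weighted_sum0 => [|i j ij|]; first 1 last.
  - apply: contraNeq c => /pairsum_neq0; rewrite hi => /addnI ->.
    by rewrite addnC ij.
  - by rewrite (@leq_add k l 2 2).
  by apply: contraNeq c => /pairsum_neq0; rewrite hi => /addnI ->.
have fx' i : fits q y z (x i) by case: (fx i).
have w22 : weight q y z 2 2 2 2 = 1 by rewrite /weight /IKweight !inordK.
have w00 : weight q y z 0 0 0 0 = 1 by rewrite /weight /IKweight !inordK.
rewrite {hi}/R; case: Ld Ls uL c => [|a [|b [|? ?]]] [|a1 [|a2 [|a3 [|a4 [|? ?]]]]];
  rewrite /= ?inE ?negb_or ?andbT => uL; case: k k3 => [|[|[|//]]] _;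
    case: l l3 => [|[|[|//]]] _ // _;
  rewrite /weighted_sum /=.
- rewrite w00 mul1r /pairsum /= !big_seq1 /uppers /lowers /= !locE /=.
  by rewrite !big_nil !mulr1.
- have [? ?] := fx a1; rewrite !(pairsum_steps10, pairsum_steps01) //
    (pts01_exchange gq rW) //.
  by rewrite (norm1C _ _ y z); ring.
- have [? ?] := fx a1; rewrite !(pairsum_steps10, pairsum_steps01) //
    (pts10_exchange gq rW) //.
  by rewrite (norm1C _ _ y z); ring.
- have a12 := gx uL; have d12 := point_apart gq (u a1) (u a2) a12.
  rewrite !(pairsum_steps02, pairsum_steps11, pairsum_steps20) //
    (pts02_exchange gq rW) // /norm2.
  by rewrite !(norm1C _ _ y z); ring.
- have a12 := gx uL; have d12 := point_apart gq (u a1) (u a2) a12.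
  rewrite !(pairsum_steps02, pairsum_steps11, pairsum_steps20) //
    (pts11_exchange gq rW) // /norm2.
  by rewrite !(norm1C _ _ y z); ring.
- have a12 := gx uL; have d12 := point_apart gq (u a1) (u a2) a12.
  rewrite !(pairsum_steps02, pairsum_steps11, pairsum_steps20) //
    (pts20_exchange gq rW) // /norm2.
  by rewrite !(norm1C _ _ y z); ring.
- case/andP: uL => /andP[/gx a12 /gx a13] /gx a23.
  have d12 := point_apart gq (u a1) (u a2) a12.
  have d13 := point_apart gq (u a1) (u a3) a13.
  have d23 := point_apart gq (u a2) (u a3) a23.
  rewrite !(pairsum_steps12, pairsum_steps21) // (pts12_exchange gq rW) //.
  by rewrite !(norm1C _ _ y z); ring.
- case/andP: uL => /andP[/gx a12 /gx a13] /gx a23.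
  have d12 := point_apart gq (u a1) (u a2) a12.
  have d13 := point_apart gq (u a1) (u a3) a13.
  have d23 := point_apart gq (u a2) (u a3) a23.
  rewrite !(pairsum_steps12, pairsum_steps21) // (pts21_exchange gq rW) //.
  by rewrite !(norm1C _ _ y z); ring.
- case/and3P: uL => /and3P[/gx a12 /gx a13 /gx a14] /andP[/gx a23 /gx a24] /gx a34.
  rewrite !pairsum_steps22 // pts22C ?point_apart // w22 mul1r.
  by rewrite !(norm1C _ _ y z).
- have [? ?] := fx a; rewrite !(pairsum_jump02, pairsum_jump11, pairsum_jump20).
  by rewrite (jmp02_exchange gq rW) //; ring.
- have [? ?] := fx a; rewrite !(pairsum_jump02, pairsum_jump11, pairsum_jump20).
  by rewrite (jmp11_exchange gq rW) //; ring.
- have [? ?] := fx a; rewrite !(pairsum_jump02, pairsum_jump11, pairsum_jump20).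
  by rewrite (jmp20_exchange gq rW) //; ring.
- have a01 := gx uL; have [d1 d2 d3] := jump_point (u a1) a01; have [? ?] := fx a.
  rewrite !(pairsum_mix12, pairsum_mix21) // (mix12_exchange gq rW) //
    !(norm1C _ _ y z); ring.
- have a01 := gx uL; have [d1 d2 d3] := jump_point (u a1) a01; have [? ?] := fx a.
  rewrite !(pairsum_mix12, pairsum_mix21) // (mix21_exchange gq rW) //
    !(norm1C _ _ y z); ring.
- case/andP: uL => /andP[/gx a01 /gx a02] /gx a12; have [? ?] := fx a.
  have [d1 d2 d3] := jump_point (u a1) a01; have [d4 d5 d6] := jump_point (u a2) a02.
  rewrite !pairsum_mix22 // (mix22C gq) ?point_apart // w22 mul1r.
  by rewrite !(norm1C _ _ y z).
- have [? ?] := fx a; have [? ?] := fx b.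
  by rewrite !pairsum_jumps22 w22 mul1r; apply: jmps22C => //; exact: gx.
Qed.
End Relation.

(** * Permutation invariance and the exchange relations *)

Lemma generic_x_apart (F : fieldType) (N : nat) (q : F) (x : 'I_N -> F) :
  generic_x q x -> forall i j, i != j -> apart q (x i) (x j).
Proof.
by move=> hx i j ij; have [? ?] := hx i j ij; have [|_ ?] := hx j i;
  first by rewrite eq_sym.
Qed.

Lemma entry_Gamma_perm (F : fieldType) (N : nat) (q : F) (x : 'I_N -> F)
    (k : 'I_3) (z : F) (g : 'S_N) (s t : config N) :
  entry (Gamma k q (fun a => x (g a)) z) [ffun a => s (g a)] [ffun a => t (g a)]
  = entry (Gamma k q x z) s t.
Proof.
rewrite !entry_Gamma; apply: loc_perm.
have -> : sites (fun a => x (g a)) [ffun a => s (g a)] [ffun a => t (g a)] =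
    [seq site_of x s t i | i <- [seq g a | a <- index_enum 'I_N]].
  by rewrite /sites -map_comp; apply: eq_map => a; rewrite /site_of /= !ffunE.
apply/perm_map/uniq_perm; rewrite ?index_enum_uniq
  ?(map_inj_uniq perm_inj) ?index_enum_uniq //.
move=> i; rewrite mem_index_enum; apply/mapP; exists ((g^-1)%g i);
  rewrite ?mem_index_enum //.
by rewrite permKV.
Qed.

(** When [t] lies below [s], every change is a jump or a step. *)
Lemma changed_sites (F : fieldType) (N : nat) (x : 'I_N -> F) (s t : config N) :
  (forall i, (t i <= s i)%N) ->
  exists Ld Ls (u : 'I_N -> bool),
   [/\ uniq (Ld ++ Ls), perm_eq (Ld ++ Ls) (changed s t) &
   [seq site_of x s t i | i <- Ld ++ Ls] =
    [seq jump (x i) | i <- Ld] ++ [seq step (x i) (u i) | i <- Ls]].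
Proof.
move=> ts; pose b i := (t i == 0 :> nat)%N && (s i == 2 :> nat)%N.
exists [seq i <- changed s t | b i], [seq i <- changed s t | ~~ b i].
exists (fun i => t i == 1 :> nat)%N.
have p := permEl (perm_filterC b (changed s t)); split=> //.
  by rewrite (perm_uniq p) filter_uniq ?index_enum_uniq.
rewrite map_cat; congr (_ ++ _); apply/eq_in_map => i; rewrite mem_filter.
  by case/andP=> /andP[/eqP t0 /eqP sE] _; rewrite /site_of t0 sE.
rewrite mem_changed -val_eqE => /andP[] /=; rewrite /b /site_of /step.
case: (s i) (t i) (ts i) => [[|[|[|//]]] ?] [[|[|[|//]]] ?] //.
Qed.

Theorem theorem1p9p1 (F : fieldType) (N : nat) (q : F) (x : 'I_N -> F)
    (hN : (0 < N)%N) (hq : generic_q q) (hx : generic_x q x) :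
  (forall (k : 'I_3) (z : F), generic_z q x z ->
     forall (s : 'S_N) (i j : config N),
       entry (Gamma k q (fun a : 'I_N => x (s a)) z)
             [ffun a : 'I_N => i (s a)] [ffun a : 'I_N => j (s a)]
       = entry (Gamma k q x z) i j)
  /\
  (forall (k l : 'I_3) (z y : F),
     generic_z q x z -> generic_z q x y -> generic_W q y z ->
     Gamma k q x z * Gamma l q x y
     = \sum_(i < 3) \sum_(j < 3)
         IKweight q y z i j k l *: (Gamma j q x y * Gamma i q x z)).
Proof.
have gx := generic_x_apart hx; split=> [k z _ s i j|k l z y [z0 rz] [y0 ry] rW].
  exact: entry_Gamma_perm.
apply: operatorP => s t; rewrite entry_sum.
under [RHS]eq_bigr do rewrite entry_sum.
under [RHS]eq_bigr do under eq_bigr do rewrite entryZ.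
have [/forallP ts|nts] := boolP [forall i, (t i <= s i)%N]; last first.
  have pC : perm_eq (changed s t) (changed s t) by [].
  rewrite (entry_product hq gx _ _ _ _ pC) (negPf nts) big1 // => i _;
    rewrite big1 // => j _.
  by rewrite (entry_product hq gx _ _ _ _ pC) (negPf nts) mulr0.
have [Ld [Ls [u [uL pL siteL]]]] := changed_sites x ts.
have /forallP ts' := ts.
rewrite (entry_product hq gx _ _ _ _ pL) ts' siteL.
rewrite (pairsum_exchange u hq z0 y0 rW gx) // => [|i]; last by split.
rewrite -weighted_sumE mulr_sumr; apply: eq_bigr => i _.
rewrite mulr_sumr; apply: eq_bigr => j _.
by rewrite (entry_product hq gx _ _ _ _ pL) ts' siteL bystandersC mulrCA.
Qed.
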